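(* Let $f\in L_1(\mathbb R)$ and $x_0\in\mathbb R$ be such that the one-sided limits $f(x_0-0)$ and $f(x_0+0)$ exist, and suppose that for some $\delta>0$ the integrals $$\int_0^\delta\frac{f(x_0-y)-f(x_0-0)}{y}\,dy,\qquad \int_0^\delta\frac{f(x_0+y)-f(x_0+0)}{y}\,dy$$ exist (the integrands being Lebesgue integrable on $(0,\delta)$). Let $\mathbf a=\{a_k\}_{k\ge0}$ with $\operatorname{Im}a_k>0$ have no limit points on the real axis $\mathbb R$, satisfy $\lim_{n\to\infty}\sigma_n=+\infty$, and satisfy $\varsigma_n/\sigma_n\le C$ for all $n\ge1$ with a constant $C$. Then $$\lim_{n\to\infty}S_n(f;\mathbf a;x_0)=\frac{f(x_0-0)+f(x_0+0)}{2}.$$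
   Context: Let $\Phi_n^+$ ($n\ge0$) be built from $\mathbf a$ and $\Phi_n^-$ ($n\ge1$) from $b_k:=\overline{a_{k-1}}$ ($k\ge1$) as follows: $\chi_k^+:=\frac{|1+a_k^2|}{1+a_k^2}$, $B_0^+:=1$, $B_n^+(z):=\prod_{k=0}^{n-1}\chi_k^+\frac{z-a_k}{z-\overline{a_k}}$, $\Phi_n^+(z):=\frac{\sqrt{\operatorname{Im}a_n}}{z-\overline{a_n}}B_n^+(z)$; $\chi_k^-:=\frac{|1+b_k^2|}{1+b_k^2}$, $B_1^-:=1$, $B_n^-(z):=\prod_{k=1}^{n-1}\chi_k^-\frac{z-b_k}{z-\overline{b_k}}$, $\Phi_n^-(z):=\frac{\sqrt{-\operatorname{Im}b_n}}{z-\overline{b_n}}B_n^-(z)$ (unimodular constants $\chi$ taken to be $1$ if the denominator vanishes); $\Phi_n:=\Phi_n^+$ for $n\ge0$, $\Phi_n:=\Phi_{-n}^-$ for $n\le-1$. For integrable $f$ let $c_k:=\frac1\pi\int_{-\infty}^\infty f(t)\overline{\Phi_k(t)}\,dt$ and $S_n(f;\mathbf a;x):=\sum_{k=-n}^{n-1}c_k\Phi_k(x)$. $\sigma_n:=\sum_{k=0}^{n-1}\frac{|\operatorname{Im}a_k|}{1+|a_k|^2}$, $\varsigma_n:=\sum_{k=0}^{n-1}\frac{1}{(\operatorname{Im}a_k)^2}$. ''No limit points on $\mathbb R$'' means no subsequence of $\{a_k\}$ converges to a real number. *)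

(* Defs.v *)
From Stdlib Require Import Reals Lra Lia ZArith.
Open Scope R_scope.

Definition Cx : Type := (R * R)%type.
Definition RtoC (r : R) : Cx := (r, 0).
Definition Re (z : Cx) : R := fst z.
Definition Im (z : Cx) : R := snd z.
Definition Cadd (z w : Cx) : Cx := (Re z + Re w, Im z + Im w).
Definition Copp (z : Cx) : Cx := (- Re z, - Im z).
Definition Csub (z w : Cx) : Cx := Cadd z (Copp w).
Definition Cmul (z w : Cx) : Cx :=
  (Re z * Re w - Im z * Im w, Re z * Im w + Im z * Re w).
Definition Cconj (z : Cx) : Cx := (Re z, - Im z).
Definition Cnorm (z : Cx) : R := sqrt (Re z * Re z + Im z * Im z).
Definition Cinv (z : Cx) : Cx :=
  let d := Re z * Re z + Im z * Im z in (Re z / d, - Im z / d).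
Definition Cdiv (z w : Cx) : Cx := Cmul z (Cinv w).

Fixpoint Csum (f : nat -> Cx) (n : nat) : Cx :=
  match n with O => RtoC 0 | S m => Cadd (Csum f m) (f m) end.
Fixpoint Cprod (f : nat -> Cx) (n : nat) : Cx :=
  match n with O => RtoC 1 | S m => Cmul (Cprod f m) (f m) end.
Fixpoint Rsum (f : nat -> R) (n : nat) : R :=
  match n with O => 0 | S m => Rsum f m + f m end.

Definition Ccv (u : nat -> Cx) (l : Cx) : Prop :=
  forall eps, 0 < eps -> exists N, forall n, (N <= n)%nat -> Cnorm (Csub (u n) l) < eps.

(* ---------- Lebesgue integral on R (Mikusinski's brick definition) ---------- *)
Definition brick (a b x : R) : R :=
  if Rle_dec a x then (if Rlt_dec x b then 1 else 0) else 0.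

Definition series_cv (u : nat -> R) (s : R) : Prop := Un_cv (fun n => sum_f_R0 u n) s.

Definition is_LInt (f : R -> R) (I : R) : Prop :=
  exists (lam a b : nat -> R),
    (forall k, a k < b k) /\
    (exists s, series_cv (fun k => Rabs (lam k) * (b k - a k)) s) /\
    series_cv (fun k => lam k * (b k - a k)) I /\
    (forall x, (exists s, series_cv (fun k => Rabs (lam k) * brick (a k) (b k) x) s) ->
               series_cv (fun k => lam k * brick (a k) (b k) x) (f x)).

Definition LIntegrable (f : R -> R) : Prop := exists I, is_LInt f I.

Definition is_CLInt (f : R -> Cx) (I : Cx) : Prop :=
  is_LInt (fun t => Re (f t)) (Re I) /\ is_LInt (fun t => Im (f t)) (Im I).
Definition CLIntegrable (f : R -> Cx) : Prop := exists I, is_CLInt f I.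

Definition restr_0d (d : R) (g : R -> Cx) (y : R) : Cx :=
  if Rlt_dec 0 y then (if Rlt_dec y d then g y else RtoC 0) else RtoC 0.

Definition chi (c : Cx) : Cx :=
  let w := Cadd (RtoC 1) (Cmul c c) in
  if Req_dec_T (Cnorm w) 0 then RtoC 1 else Cdiv (RtoC (Cnorm w)) w.

Definition bfactor (c z : Cx) : Cx :=
  Cmul (chi c) (Cdiv (Csub z c) (Csub z (Cconj c))).

Definition Bplus (a : nat -> Cx) (n : nat) (z : Cx) : Cx :=
  Cprod (fun k => bfactor (a k) z) n.
Definition Phiplus (a : nat -> Cx) (n : nat) (z : Cx) : Cx :=
  Cmul (Cdiv (RtoC (sqrt (Im (a n)))) (Csub z (Cconj (a n)))) (Bplus a n z).

(* b_k := conj (a_{k-1}), k >= 1 *)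
Definition bseq (a : nat -> Cx) (k : nat) : Cx := Cconj (a (k - 1)%nat).
Definition Bminus (a : nat -> Cx) (n : nat) (z : Cx) : Cx :=
  Cprod (fun j => bfactor (bseq a (S j)) z) (n - 1)%nat.
Definition Phiminus (a : nat -> Cx) (n : nat) (z : Cx) : Cx :=
  Cmul (Cdiv (RtoC (sqrt (- Im (bseq a n)))) (Csub z (Cconj (bseq a n)))) (Bminus a n z).

Definition Phi (a : nat -> Cx) (k : Z) (z : Cx) : Cx :=
  if Z.leb 0 k then Phiplus a (Z.to_nat k) z else Phiminus a (Z.to_nat (- k)) z.

Definition Spartial (a : nat -> Cx) (c : Z -> Cx) (n : nat) (x : R) : Cx :=
  Csum (fun j => let k := (Z.of_nat j - Z.of_nat n)%Z in
                 Cmul (c k) (Phi a k (RtoC x))) (2 * n).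

Definition sigmaN (a : nat -> Cx) (n : nat) : R :=
  Rsum (fun k => Rabs (Im (a k)) / (1 + Cnorm (a k) ^ 2)) n.
Definition varsigmaN (a : nat -> Cx) (n : nat) : R :=
  Rsum (fun k => 1 / (Im (a k)) ^ 2) n.

Definition no_real_limit_points (a : nat -> Cx) : Prop :=
  forall (phi : nat -> nat) (x : R),
    (forall n, (phi n < phi (S n))%nat) -> ~ Ccv (fun n => a (phi n)) (RtoC x).

(* Main.v *)
From Stdlib Require Import Reals ZArith Lra Lia Psatz Classical ClassicalEpsilon.
From Coquelicot Require Import Rcomplements Rbar Hierarchy Lim_seq Continuity Derive RInt RInt_analysis AutoDerive.
Require Import Defs.
Open Scope R_scope.

(* On the real axis the Blaschke product of the [a k] is [exp (i theta_n)] up to a constant, with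
   [theta_n] a sum of arctangents, and the kernel [sum_k conj (Phi_k t) (Phi_k x0)] telescopes to
   [sin (theta_n t - theta_n x0) / (t - x0)].  On a compact interval the absence of real limit
   points gives [|theta_n''| <= M theta_n'] with [M] independent of [n], and
   [theta_n' >= c sigma_n], which tends to infinity.  Integration by parts then yields a
   Riemann-Lebesgue lemma for the phases [theta_n] on intervals, hence on integrable functions
   by dominated summation over bricks; it disposes of the Dini quotients near [x0] and of [f]
   away from [x0].  The constants [f (x0 - 0)] and [f (x0 + 0)] against the kernel each
   contribute the Dirichlet integral [PI / 2], by comparison with [Si (theta_n t - theta_n x0)].
   The linearity and uniqueness of the brick integral rest on a comparison principle for
   increments of a continuous function off a countable set. *)

(** The coefficients [c k] are known only through [is_CLInt], which certifies a value by exhibiting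
    one brick series. Writing [Spartial] as a single integral against the kernel takes linearity,
    and cutting that integral into pieces takes uniqueness. Neither is immediate for bricks, and a
    brick series times a smooth factor is no longer a brick series. The integral [gint] is shaped
    for this: its terms carry primitives, so every estimate is one on increments and no measure
    theory enters.

    The indices from [-n] to [n-1] form pairs [k], [-k-1] whose functions are conjugate on the real
    axis. Each pair contributes twice a real part, which is why the kernel is a real sine.

    The constant [PI / 2] comes from the classical Dirichlet kernel, whose primitive is explicit; it
    passes to [Si] along the odd multiples of [PI / 2], then to [Si] at infinity, then to a general
    phase. In the last transfer the bound on the second derivative serves once more: for a phase [u]
    vanishing at 0 it gives [|u - y u'| <= M y u], so [1 / y] and [u' / u] differ by at most [M],
    uniformly in [n]. *)

Lemma Rsum_ext (u v : nat -> R) n :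
  (forall k, (k < n)%nat -> u k = v k) -> Rsum u n = Rsum v n.
Proof.
  induction n as [|n IH]; intros H; simpl; [reflexivity|].
  rewrite IH, H; auto with arith.
Qed.

Lemma Rsum_plus (u v : nat -> R) n :
  Rsum (fun k => u k + v k) n = Rsum u n + Rsum v n.
Proof. induction n as [|n IH]; simpl; [ring | rewrite IH; ring]. Qed.

Lemma Rsum_scal (c : R) (u : nat -> R) n :
  Rsum (fun k => c * u k) n = c * Rsum u n.
Proof. induction n as [|n IH]; simpl; [ring | rewrite IH; ring]. Qed.

Lemma Rsum_minus (u v : nat -> R) n :
  Rsum (fun k => u k - v k) n = Rsum u n - Rsum v n.
Proof. induction n as [|n IH]; simpl; [ring | rewrite IH; ring]. Qed.

Lemma Rsum_le (u v : nat -> R) n :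
  (forall k, (k < n)%nat -> u k <= v k) -> Rsum u n <= Rsum v n.
Proof.
  induction n as [|n IH]; intros H; simpl; [lra|].
  apply Rplus_le_compat; auto with arith.
Qed.

Lemma Rsum_nonneg (u : nat -> R) n : (forall k, 0 <= u k) -> 0 <= Rsum u n.
Proof.
  intros H; induction n as [|n IH]; simpl; [lra|]. specialize (H n); lra.
Qed.

Lemma Rsum_Rabs (u : nat -> R) n : Rabs (Rsum u n) <= Rsum (fun k => Rabs (u k)) n.
Proof.
  induction n as [|n IH]; simpl; [rewrite Rabs_R0; lra|].
  eapply Rle_trans; [apply Rabs_triang|lra].
Qed.

Lemma Rsum_app (u : nat -> R) N n :
  Rsum u (N + n) = Rsum u N + Rsum (fun k => u (N + k)%nat) n.
Proof.
  induction n as [|n IH]; simpl.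
  - rewrite Nat.add_0_r; ring.
  - rewrite Nat.add_succ_r; simpl; rewrite IH; ring.
Qed.

Lemma Rsum_incr (u : nat -> R) n p :
  (forall k, 0 <= u k) -> (n <= p)%nat -> Rsum u n <= Rsum u p.
Proof.
  intros H Hnp. replace p with (n + (p - n))%nat by lia.
  rewrite Rsum_app.
  pose proof (Rsum_nonneg (fun k => u (n + k)%nat) (p - n) (fun k => H _)); lra.
Qed.

Lemma Rsum_ge_term (u : nat -> R) j n :
  (forall k, 0 <= u k) -> (j < n)%nat -> u j <= Rsum u n.
Proof.
  intros H Hj. apply Rle_trans with (Rsum u (S j)).
  - simpl. pose proof (Rsum_nonneg u j H); lra.
  - apply Rsum_incr; auto.
Qed.

Lemma Rsum_geom (eta : R) n : 0 <= eta -> Rsum (fun k => eta / 2 ^ k) n <= 2 * eta.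
Proof.
  intros He.
  assert (H : Rsum (fun k => eta / 2 ^ k) n = 2 * eta - 2 * eta / 2 ^ n).
  { induction n as [|n IH]; simpl; [field|]. rewrite IH. field. apply pow_nonzero; lra. }
  rewrite H.
  assert (0 <= 2 * eta / 2 ^ n).
  { apply Rmult_le_pos; [lra|]. left; apply Rinv_0_lt_compat, pow_lt; lra. }
  lra.
Qed.

Lemma functional_choice (A B : Type) (P : A -> B -> Prop) :
  (forall x, exists y, P x y) -> exists f : A -> B, forall x, P x (f x).
Proof.
  intros H; exists (fun x => proj1_sig (constructive_indefinite_description _ (H x))).
  intros x; apply proj2_sig.
Qed.

(** * Comparison of increments off a countable set *)

Definition avoids (e : nat -> R) (x : R) : Prop := forall j, x <> e j.

Definition interleave (e e' : nat -> R) (n : nat) : R :=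
  if Nat.even n then e (Nat.div2 n) else e' (Nat.div2 n).

Lemma avoids_interleave (e e' : nat -> R) x :
  avoids (interleave e e') x -> avoids e x /\ avoids e' x.
Proof.
  intros H; split; intros j E.
  - apply (H (2 * j)%nat). unfold interleave.
    rewrite Nat.even_mul, Nat.div2_double; exact E.
  - apply (H (S (2 * j))). unfold interleave.
    rewrite Nat.even_succ, <- Nat.negb_even, Nat.even_mul, Nat.div2_succ_double; exact E.
Qed.

(* [G] plays the role of the primitives of a nonnegative series dominating the
   derivative of [F] off the sequence [e]; at the points of [e] the continuity of
   [F] is enough, each of them being allowed a jump [eta / 2 ^ k]. *)
Lemma increment_le_Rsum (F : R -> R) (G : nat -> R -> R) (e : nat -> R) (A B s : R) :
  A <= B ->
  (forall x, continuity_pt F x) ->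
  (forall k x y, x <= y -> G k x <= G k y) ->
  (forall x, A <= x < B -> avoids e x -> forall eta, 0 < eta -> exists n h0, 0 < h0 /\
     forall h, 0 < h < h0 ->
       F (x + h) - F x <= Rsum (fun k => G k (x + h) - G k x) n + eta * h) ->
  (forall n, Rsum (fun k => G k B - G k A) n <= s) ->
  F B - F A <= s.
Proof.
  intros HAB HF HG Hloc Hs.
  apply le_epsilon; intros eps Heps.
  (* The slack [eps] is spent as [eta * (B - A)] on the slopes, at most [2 * eta] on the jumps and
     one [eta] on the margin [ep] in [T]. *)
  set (eta := eps / (B - A + 3)).
  assert (Heta : 0 < eta) by (apply Rdiv_lt_0_compat; lra).
  (* The strict inequality matters: at [t = e k] the allowance is still unspent and becomes
     available for any step to the right of [t]. *)
  set (J := fun t k => if Rlt_dec (e k) t then eta / 2 ^ k else 0).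
  assert (Hp : forall k, 0 < eta / 2 ^ k)
    by (intros k; apply Rdiv_lt_0_compat; [lra | apply pow_lt; lra]).
  assert (HJ0 : forall t k, 0 <= J t k).
  { intros t k; unfold J; destruct Rlt_dec; [left; apply Hp|lra]. }
  assert (HJm : forall t t' k, t <= t' -> 0 <= J t' k - J t k).
  { intros t t' k Ht; unfold J; pose proof (Hp k).
    destruct (Rlt_dec (e k) t), (Rlt_dec (e k) t'); lra. }
  (* A supremum argument. The margin [ep] lets [n] depend on the accuracy, so that [T] contains its
     supremum although the series of the [G k] is cut off. *)
  set (T := fun t => A <= t <= B /\ forall ep, 0 < ep -> exists n,
    F t - F A <= Rsum (fun k => G k t - G k A) n + eta * (t - A) + Rsum (J t) n + ep).
  assert (HTA : T A).
  { split; [lra|]. intros ep Hep; exists O; simpl; lra. }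
  assert (Hext : forall t t' n p, A <= t -> t <= t' -> (n <= p)%nat ->
    Rsum (fun k => G k t - G k A) n <= Rsum (fun k => G k t' - G k A) p /\
    Rsum (J t) n <= Rsum (J t') p).
  { intros t t' n p HA Ht Hn; split.
    - apply Rle_trans with (Rsum (fun k => G k t' - G k A) n).
      + apply Rsum_le; intros k _; pose proof (HG k t t' Ht); lra.
      + apply Rsum_incr; [|exact Hn].
        intros k; pose proof (HG k A t' (Rle_trans _ _ _ HA Ht)); lra.
    - apply Rle_trans with (Rsum (J t') n).
      + apply Rsum_le; intros k _; pose proof (HJm t t' k Ht); lra.
      + apply Rsum_incr; auto. }
  destruct (completeness T) as [t [Hub Hlub]].
  { exists B; intros x [Hx _]; lra. }
  { exists A; exact HTA. }
  assert (HAt : A <= t) by (apply Hub; exact HTA).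
  assert (HtB : t <= B) by (apply Hlub; intros x [Hx _]; lra).
  assert (HT : T t).
  { split; [lra|]. intros ep Hep.
    destruct (HF t (ep / 2)) as [d [Hd Hc]]; [lra|].
    assert (Hex : exists y, T y /\ t - d < y).
    { apply NNPP; intros Hn. assert (t <= t - d); [|lra].
      apply Hlub; intros y Hy. destruct (Rle_dec y (t - d)); [assumption|].
      exfalso; apply Hn; exists y; split; [assumption|lra]. }
    destruct Hex as [y [Ty Hy]]. assert (Hyt : y <= t) by (apply Hub; exact Ty).
    destruct Ty as [[HyA _] Ty]. destruct (Ty (ep / 2)) as [n Hn]; [lra|].
    exists n. destruct (Hext y t n n HyA Hyt (le_n _)) as [H1 H2].
    assert (eta * (y - A) <= eta * (t - A)) by (apply Rmult_le_compat_l; lra).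
    assert (Rabs (F y - F t) < ep / 2).
    { destruct (Req_dec y t) as [->|Hne]; [rewrite Rminus_diag, Rabs_R0; lra|].
      apply Hc; split; [split; [exact I|auto]|].
      simpl; unfold Rdist; rewrite Rabs_left1; lra. }
    apply Rabs_lt_between in H0. lra. }
  destruct (Req_dec t B) as [->|HneB].
  { destruct HT as [_ HT]. destruct (HT eta Heta) as [n Hn].
    pose proof (Hs n).
    assert (Rsum (J B) n <= 2 * eta).
    { eapply Rle_trans; [|apply (Rsum_geom eta n); lra].
      apply Rsum_le; intros k _; unfold J; pose proof (Hp k); destruct Rlt_dec; lra. }
    assert (eta * (B - A + 3) = eps) by (unfold eta; field; lra).
    lra. }
  exfalso.
  assert (Hstep : forall h, 0 < h -> t + h <= B ->
    (forall ep, 0 < ep -> exists n, F (t + h) - F A <=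
      Rsum (fun k => G k (t + h) - G k A) n + eta * (t + h - A) + Rsum (J (t + h)) n + ep)
    -> False).
  { intros h Hh HhB H. assert (t + h <= t); [|lra].
    apply Hub; split; [lra|exact H]. }
  destruct HT as [_ HT].
  (* A supremum below [B] is pushed further right: off [e] by the local hypothesis, at a point [e j]
     by continuity of [F] and the allowance [eta / 2 ^ j]. *)
  destruct (classic (avoids e t)) as [Hav|Hav].
  - destruct (Hloc t ltac:(lra) Hav eta Heta) as [n0 [h0 [Hh0 Hl]]].
    set (h := Rmin (h0 / 2) (B - t)).
    assert (Hh : 0 < h) by (apply Rmin_glb_lt; lra).
    assert (h <= h0 / 2) by apply Rmin_l. assert (h <= B - t) by apply Rmin_r.
    apply (Hstep h); [lra|lra|]. intros ep Hep.
    destruct (HT ep Hep) as [n1 Hn1]. exists (max n0 n1).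
    destruct (Hext t t n1 (max n0 n1)) as [E1 _]; [lra|lra|lia|].
    destruct (Hext t (t + h) n1 (max n0 n1)) as [_ E2]; [lra|lra|lia|].
    specialize (Hl h ltac:(lra)).
    assert (E3 : Rsum (fun k => G k (t + h) - G k t) n0 <=
                 Rsum (fun k => G k (t + h) - G k t) (max n0 n1)).
    { apply Rsum_incr; [|lia]. intros k; pose proof (HG k t (t + h)); lra. }
    assert (E4 : Rsum (fun k => G k (t + h) - G k A) (max n0 n1) =
      Rsum (fun k => G k (t + h) - G k t) (max n0 n1) +
      Rsum (fun k => G k t - G k A) (max n0 n1)).
    { rewrite <- Rsum_plus; apply Rsum_ext; intros; ring. }
    lra.
  - assert (Hj : exists j, t = e j).
    { apply NNPP; intros Hn; apply Hav; intros j E; apply Hn; exists j; exact E. }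
    destruct Hj as [j Hj].
    destruct (HF t (eta / 2 ^ j) (Hp j)) as [d [Hd Hc]].
    set (h := Rmin (d / 2) (B - t)).
    assert (Hh : 0 < h) by (apply Rmin_glb_lt; lra).
    assert (h <= d / 2) by apply Rmin_l. assert (h <= B - t) by apply Rmin_r.
    apply (Hstep h); [lra|lra|]. intros ep Hep.
    destruct (HT ep Hep) as [n1 Hn1]. exists (max (S j) n1).
    destruct (Hext t (t + h) n1 (max (S j) n1)) as [E1 _]; [lra|lra|lia|].
    destruct (Hext t t n1 (max (S j) n1)) as [_ E2]; [lra|lra|lia|].
    assert (E3 : eta / 2 ^ j <= Rsum (fun k => J (t + h) k - J t k) (max (S j) n1)).
    { replace (eta / 2 ^ j) with (J (t + h) j - J t j).
      - apply (Rsum_ge_term (fun k => J (t + h) k - J t k)); [|lia].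
        intros k; apply HJm; lra.
      - unfold J; rewrite <- Hj.
        destruct (Rlt_dec t (t + h)), (Rlt_dec t t); lra. }
    rewrite Rsum_minus in E3.
    assert (E4 : Rabs (F (t + h) - F t) < eta / 2 ^ j).
    { apply Hc; split; [split; [exact I|lra]|].
      simpl; unfold Rdist; rewrite Rabs_right; lra. }
    apply Rabs_lt_between in E4.
    assert (0 <= eta * h) by (apply Rmult_le_pos; lra).
    lra.
Qed.

(** * Integration by dominated series of primitives *)

Definition Rsum_bounded (u : nat -> R) : Prop := exists s, forall n, Rsum u n <= s.

Lemma Rsum_bounded_le (u v : nat -> R) :
  (forall k, u k <= v k) -> Rsum_bounded v -> Rsum_bounded u.
Proof.
  intros H [s Hs]; exists s; intros n.
  eapply Rle_trans; [apply Rsum_le; intros k _; apply H|apply Hs].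
Qed.

Lemma Rsum_bounded_scal (c : R) (u : nat -> R) :
  0 <= c -> Rsum_bounded u -> Rsum_bounded (fun k => c * u k).
Proof.
  intros Hc [s Hs]; exists (c * s); intros n; rewrite Rsum_scal.
  apply Rmult_le_compat_l; auto.
Qed.

Lemma Rsum_bounded_plus (u v : nat -> R) :
  Rsum_bounded u -> Rsum_bounded v -> Rsum_bounded (fun k => u k + v k).
Proof.
  intros [s Hs] [t Ht]; exists (s + t); intros n; rewrite Rsum_plus.
  apply Rplus_le_compat; auto.
Qed.

Lemma Rsum_tail (m : nat -> R) :
  (forall k, 0 <= m k) -> Rsum_bounded m ->
  forall eps, 0 < eps -> exists N, forall p n, (N <= p)%nat ->
    Rsum (fun k => m (p + k)%nat) n <= eps.
Proof.
  intros Hm [s Hs] eps Heps.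
  destruct (completeness (fun x => exists n, x = Rsum m n)) as [l [Hub Hlub]].
  { exists s; intros x [n ->]; apply Hs. }
  { exists (Rsum m 0); exists O; reflexivity. }
  assert (H : exists N, l - eps < Rsum m N).
  { apply NNPP; intros Hn. assert (l <= l - eps); [|lra].
    apply Hlub; intros x [n ->]. apply Rnot_lt_le; intros H; apply Hn; exists n; exact H. }
  destruct H as [N HN]. exists N; intros p n Hp.
  pose proof (Hub _ (ex_intro _ (p + n)%nat eq_refl)) as H.
  rewrite Rsum_app in H. pose proof (Rsum_incr m N p Hm Hp). lra.
Qed.

Lemma is_lim_seq_eps (u : nat -> R) (l : R) :
  is_lim_seq u l <->
  forall eps, 0 < eps -> exists N, forall n, (N <= n)%nat -> Rabs (u n - l) < eps.
Proof.
  rewrite is_lim_seq_Reals; split; intros H eps Heps; destruct (H eps Heps) as [N HN];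
    exists N; intros n Hn; apply HN; lia.
Qed.

Lemma is_lim_seq_Rsum_le (u v : nat -> R) (l : R) N :
  is_lim_seq (Rsum u) l -> (forall k, Rabs (u k) <= v k) ->
  forall eps, 0 < eps -> exists n,
    Rsum u N - l <= Rsum (fun k => v (N + k)%nat) n + eps.
Proof.
  intros H Huv eps Heps. apply is_lim_seq_eps with (eps := eps) in H; [|exact Heps].
  destruct H as [p Hp]. exists p. specialize (Hp (N + p)%nat ltac:(lia)).
  rewrite Rsum_app in Hp. apply Rabs_lt_between in Hp.
  assert (- Rsum (fun k => u (N + k)%nat) p <= Rsum (fun k => v (N + k)%nat) p).
  { rewrite <- (Rmult_1_l (Rsum (fun k => u (N + k)%nat) p)), <- Ropp_mult_distr_l_reverse,
      <- Rsum_scal.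
    apply Rsum_le; intros k _. pose proof (Huv (N + k)%nat) as Hk.
    pose proof (Rle_abs (- u (N + k)%nat)). rewrite Rabs_Ropp in H. lra. }
  lra.
Qed.

(** The last clause encodes compact support, so the integrals [i] of [u] and [m] of [v] are eventual
    values of the primitives and not limits. Monotonicity of [V] is asked everywhere, since it feeds
    the [G k] of [increment_le_Rsum]. *)
Definition gterm (e : nat -> R) (u U v V : R -> R) (i m : R) : Prop :=
  (forall x, continuity_pt U x) /\
  (forall x y, x <= y -> V x <= V y) /\
  (forall x, avoids e x -> is_derive U x (u x) /\ is_derive V x (v x) /\ Rabs (u x) <= v x) /\
  (exists r, forall x, (x <= - r -> U x = 0 /\ V x = 0) /\ (r <= x -> U x = i /\ V x = m)).

(* A form of the Lebesgue integral that allows continuous integrands on the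
   bricks: [f] is the sum of the series of the [u k], with primitives [U k] and
   integrals [i k], wherever the dominating series of the [v k] converges.  The
   countable set [e] makes it insensitive to the end points of the bricks. *)
Definition gint (f : R -> R) (I : R) : Prop :=
  exists (e : nat -> R) (u U v V : nat -> R -> R) (i m : nat -> R),
    (forall k, gterm e (u k) (U k) (v k) (V k) (i k) (m k)) /\
    Rsum_bounded m /\
    is_lim_seq (Rsum i) I /\
    (forall x, avoids e x -> Rsum_bounded (fun k => v k x) ->
               is_lim_seq (Rsum (fun k => u k x)) (f x)).

Lemma gterm_intro (e : nat -> R) (u U v V : R -> R) (i m : R) :
  (forall x, continuity_pt U x) ->
  (forall x y, x <= y -> V x <= V y) ->
  (forall x, avoids e x -> is_derive U x (u x)) ->
  (forall x, avoids e x -> is_derive V x (v x)) ->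
  (forall x, avoids e x -> Rabs (u x) <= v x) ->
  (exists r, forall x, (x <= - r -> U x = 0 /\ V x = 0) /\ (r <= x -> U x = i /\ V x = m)) ->
  gterm e u U v V i m.
Proof. intros; split; [|split; [|split]]; auto. Qed.

Lemma gterm_avoids (e e' : nat -> R) u U v V i m :
  (forall x, avoids e' x -> avoids e x) ->
  gterm e u U v V i m -> gterm e' u U v V i m.
Proof. intros H (H1 & H2 & H3 & H4); split; [|split; [|split]]; auto. Qed.

Lemma gterm_bounds e u U v V i m :
  gterm e u U v V i m -> 0 <= m /\ forall x y, V y - V x <= m.
Proof.
  intros (_ & H2 & _ & [r Hr]).
  assert (H : forall x, 0 <= V x <= m).
  { intros x. set (y := Rmax r (Rmax x (-x))).
    assert (r <= y) by apply Rmax_l.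
    assert (Rmax x (-x) <= y) by apply Rmax_r.
    pose proof (Rmax_l x (-x)). pose proof (Rmax_r x (-x)).
    destruct (Hr y) as [_ [_ Hy]]; [lra|].
    destruct (Hr (- y)) as [[_ Hy'] _]; [lra|].
    pose proof (H2 (- y) x). pose proof (H2 x y). lra. }
  split; [pose proof (H 0); lra|]. intros x y; pose proof (H x); pose proof (H y); lra.
Qed.

(** This is what frees the later identities from the singular point [x0] and from the end points of
    bricks. *)
Lemma gint_ext (f g : R -> R) (I : R) (e' : nat -> R) :
  (forall x, avoids e' x -> f x = g x) -> gint f I -> gint g I.
Proof.
  intros H (e & u & U & v & V & i & m & H1 & H2 & H3 & H4).
  exists (interleave e e'), u, U, v, V, i, m; split; [|split; [|split]]; auto.
  - intros k; apply (gterm_avoids e); auto; intros x Hx; apply avoids_interleave in Hx; tauto.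
  - intros x Hx Hb; apply avoids_interleave in Hx. rewrite <- H by tauto. apply H4; tauto.
Qed.

Lemma Rsum_continuity (U : nat -> R -> R) x n :
  (forall k, continuity_pt (U k) x) -> continuity_pt (fun t => Rsum (fun k => U k t) n) x.
Proof.
  intros H; induction n as [|n IH]; simpl.
  - apply continuity_pt_const; intros ? ?; reflexivity.
  - apply continuity_pt_plus; auto.
Qed.

Lemma is_derive_cst (c x : R) : is_derive (fun _ : R => c) x 0.
Proof. exact (@is_derive_const R_AbsRing R_NormedModule c x). Qed.

Lemma Rsum_derive (U : nat -> R -> R) (u : nat -> R) x n :
  (forall k, is_derive (U k) x (u k)) ->
  is_derive (fun t => Rsum (fun k => U k t) n) x (Rsum u n).
Proof.
  intros H; induction n as [|n IH]; simpl.
  - apply is_derive_cst.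
  - apply (is_derive_plus (fun t => Rsum (fun k => U k t) n) (U n) x); auto.
Qed.

Lemma is_derive_increment (F : R -> R) x l eta :
  is_derive F x l -> 0 < eta ->
  exists h0, 0 < h0 /\ forall h, 0 < h < h0 -> F (x + h) - F x <= (l + eta) * h.
Proof.
  intros H Heta. apply is_derive_Reals in H.
  destruct (H eta Heta) as [d Hd]. exists d; split; [apply cond_pos|].
  intros h Hh. specialize (Hd h ltac:(lra)).
  rewrite Rabs_right in Hd by lra. specialize (Hd ltac:(lra)).
  apply Rabs_lt_between in Hd.
  assert (E : F (x + h) - F x = ((F (x + h) - F x) / h) * h) by (field; lra).
  rewrite E; apply Rmult_le_compat_r; lra.
Qed.

(** For fixed [N], the sum of the first [N] terms [u k x] is minus the tail of a series with sum 0,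
    hence at most the tail of the [v k x]. The comparison of increments turns this pointwise bound
    into one of [Rsum i N] by the tail of [m], which tends to 0. *)
Lemma gint_0_le (I : R) : gint (fun _ => 0) I -> I <= 0.
Proof.
  intros (e & u & U & v & V & i & m & H1 & H2 & H3 & H4).
  assert (Hm : forall k, 0 <= m k) by (intros k; apply (gterm_bounds _ _ _ _ _ _ _ (H1 k))).
  assert (HR : forall N, exists r, forall k, (k < N)%nat ->
             U k r = i k /\ U k (- r) = 0 /\ 0 <= r).
  { intros N.
    assert (Hr : exists r, 0 <= r /\ forall k, (k < N)%nat -> forall x, r <= x ->
               U k x = i k /\ U k (- x) = 0).
    { induction N as [|N [r [Hr0 Hr]]]; [exists 0; split; [lra|lia]|].
      destruct (H1 N) as (_ & _ & _ & [s Hs]).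
      exists (Rmax r s). pose proof (Rmax_l r s). pose proof (Rmax_r r s).
      split; [lra|]. intros k Hk x Hx.
      destruct (Nat.eq_dec k N) as [->|Hne].
      - split; [apply Hs | apply Hs]; lra.
      - apply Hr; [lia|lra]. }
    destruct Hr as [r [Hr0 Hr]]; exists r; intros k Hk.
    destruct (Hr k Hk r); [lra|]; auto. }
  assert (Hle : forall N s, (forall n, Rsum (fun k => m (N + k)%nat) n <= s) -> Rsum i N <= s).
  { intros N s Hs. destruct (HR N) as [r Hr].
    destruct (Nat.eq_dec N 0) as [->|HN]; [specialize (Hs O); simpl in *; lra|].
    assert (Hr0 : 0 <= r) by (apply (Hr 0%nat); lia).
    replace (Rsum i N) with (Rsum (fun k => U k r) N - Rsum (fun k => U k (- r)) N).
    2:{ rewrite <- Rsum_minus; apply Rsum_ext; intros k Hk.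
        destruct (Hr k Hk) as (-> & -> & _); ring. }
    apply (increment_le_Rsum (fun t => Rsum (fun k => U k t) N) (fun k => V (N + k)%nat) e).
    - lra.
    - intros x; apply Rsum_continuity; intros k; apply H1.
    - intros k; apply H1.
    - intros x _ Hx eta Heta.
      assert (Hv : forall k, 0 <= v k x).
      { intros k; eapply Rle_trans; [apply Rabs_pos|apply (H1 k); exact Hx]. }
      assert (Hn : exists n, Rsum (fun k => u k x) N <=
                   Rsum (fun k => v (N + k)%nat x) n + eta / 2).
      (* Where the dominating series diverges the series of the [u k x] is not controlled, but then
         the tail of the [v k x] exceeds any given number, in particular the finite sum up to
         [N]. *)
      { destruct (classic (Rsum_bounded (fun k => v k x))) as [Hb|Hb].
        - destruct (is_lim_seq_Rsum_le (fun k => u k x) (fun k => v k x) 0 N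
                      (H4 x Hx Hb)) with (eps := eta / 2) as [n Hn]; [|lra|].
          + intros k; apply H1; exact Hx.
          + exists n; simpl in Hn; lra.
        - apply NNPP; intros Hn; apply Hb.
          exists (Rsum (fun k => v k x) N + Rsum (fun k => u k x) N). intros n.
          apply Rle_trans with (Rsum (fun k => v k x) (N + n)).
          + apply Rsum_incr; [exact Hv|lia].
          + rewrite Rsum_app. apply Rplus_le_compat_l.
            apply Rnot_lt_le; intros Hlt; apply Hn; exists n; lra. }
      destruct Hn as [n Hn]. exists n.
      destruct (is_derive_increment
        (fun t => Rsum (fun k => U k t) N - Rsum (fun k => V (N + k)%nat t) n) x
        (Rsum (fun k => u k x) N - Rsum (fun k => v (N + k)%nat x) n) (eta / 2))
        as [h0 [Hh0 Hh]]; [|lra|].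
      { apply (is_derive_minus (fun t => Rsum (fun k => U k t) N)
                 (fun t => Rsum (fun k => V (N + k)%nat t) n) x).
        - apply Rsum_derive; intros k; apply H1; exact Hx.
        - apply (Rsum_derive (fun k => V (N + k)%nat)); intros k; apply H1; exact Hx. }
      exists h0; split; [exact Hh0|]. intros h Hlt. specialize (Hh h Hlt).
      rewrite Rsum_minus.
      assert ((Rsum (fun k => u k x) N - Rsum (fun k => v (N + k)%nat x) n + eta / 2) * h
              <= eta * h) by (apply Rmult_le_compat_r; lra).
      lra.
    - intros n; eapply Rle_trans; [|apply (Hs n)].
      apply Rsum_le; intros k _. apply (gterm_bounds _ _ _ _ _ _ _ (H1 (N + k)%nat)). }
  apply Rnot_lt_le; intros HI.
  apply is_lim_seq_eps with (eps := I / 2) in H3; [|lra]. destruct H3 as [N1 HN1].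
  destruct (Rsum_tail m Hm H2 (I / 2)) as [N2 HN2]; [lra|].
  specialize (HN1 (max N1 N2) ltac:(lia)). apply Rabs_lt_between in HN1.
  pose proof (Hle (max N1 N2) (I / 2) (fun n => HN2 (max N1 N2) n ltac:(lia))). lra.
Qed.

(** Since both dominating series have nonnegative terms off the exceptional points, boundedness of
    their sum bounds each of them, so both pointwise limits are available at once. *)
Lemma gint_plus (f g : R -> R) (I J : R) :
  gint f I -> gint g J -> gint (fun x => f x + g x) (I + J).
Proof.
  intros (e & u & U & v & V & i & m & H1 & H2 & H3 & H4)
         (e' & u' & U' & v' & V' & i' & m' & H1' & H2' & H3' & H4').
  exists (interleave e e'), (fun k x => u k x + u' k x), (fun k x => U k x + U' k x),
    (fun k x => v k x + v' k x), (fun k x => V k x + V' k x),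
    (fun k => i k + i' k), (fun k => m k + m' k).
  assert (Hab : forall x k, avoids (interleave e e') x ->
     (is_derive (U k) x (u k x) /\ is_derive (V k) x (v k x) /\ Rabs (u k x) <= v k x) /\
     (is_derive (U' k) x (u' k x) /\ is_derive (V' k) x (v' k x) /\ Rabs (u' k x) <= v' k x)).
  { intros x k Hx; apply avoids_interleave in Hx; split; [apply H1|apply H1']; tauto. }
  split; [intros k; apply gterm_intro|split; [|split]].
  - intros x; apply continuity_pt_plus; [apply H1|apply H1'].
  - intros x y Hxy; apply Rplus_le_compat; [apply H1|apply H1']; exact Hxy.
  - intros x Hx; apply (is_derive_plus (U k) (U' k)); apply Hab; auto.
  - intros x Hx; apply (is_derive_plus (V k) (V' k)); apply Hab; auto.
  - intros x Hx; eapply Rle_trans; [apply Rabs_triang|]. apply Rplus_le_compat; apply Hab; auto.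
  - destruct (H1 k) as (_ & _ & _ & [r Hr]), (H1' k) as (_ & _ & _ & [r' Hr']).
    exists (Rmax r r'); intros x. pose proof (Rmax_l r r'). pose proof (Rmax_r r r').
    split; intros Hx.
    + destruct (Hr x) as [[-> ->] _]; [lra|]. destruct (Hr' x) as [[-> ->] _]; lra.
    + destruct (Hr x) as [_ [-> ->]]; [lra|]. destruct (Hr' x) as [_ [-> ->]]; lra.
  - apply Rsum_bounded_plus; assumption.
  - apply is_lim_seq_ext with (fun n => Rsum i n + Rsum i' n).
    + intros n; symmetry; apply Rsum_plus.
    + apply is_lim_seq_plus'; assumption.
  - intros x Hx Hb.
    apply is_lim_seq_ext with (fun n => Rsum (fun k => u k x) n + Rsum (fun k => u' k x) n).
    + intros n; symmetry; apply Rsum_plus.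
    + assert (Hp : forall k, 0 <= v k x /\ 0 <= v' k x).
      { intros k; split; (eapply Rle_trans; [apply Rabs_pos|apply (Hab x k Hx)]). }
      pose proof (avoids_interleave _ _ _ Hx) as [Hx1 Hx2].
      apply is_lim_seq_plus'; [apply H4|apply H4']; auto;
        (eapply Rsum_bounded_le; [|exact Hb]); intros k; specialize (Hp k); simpl; lra.
Qed.

Lemma gint_scal (c : R) (f : R -> R) (I : R) :
  gint f I -> gint (fun x => c * f x) (c * I).
Proof.
  intros (e & u & U & v & V & i & m & H1 & H2 & H3 & H4).
  (* [Rabs c + 1] rather than [Rabs c]: for [c = 0] the dominating series must still diverge
     where that of [f] does *)
  set (d := Rabs c + 1). assert (Hd : 1 <= d) by (unfold d; pose proof (Rabs_pos c); lra).
  exists e, (fun k x => c * u k x), (fun k x => c * U k x),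
    (fun k x => d * v k x), (fun k x => d * V k x), (fun k => c * i k), (fun k => d * m k).
  split; [intros k; apply gterm_intro|split; [|split]].
  - intros x; apply (continuity_pt_scal (U k)); apply H1.
  - intros x y Hxy; apply Rmult_le_compat_l; [lra|]; apply H1; exact Hxy.
  - intros x Hx; apply (is_derive_scal (U k)); apply H1; assumption.
  - intros x Hx; apply (is_derive_scal (V k)); apply H1; assumption.
  - intros x Hx; rewrite Rabs_mult. apply Rmult_le_compat; try apply Rabs_pos; [unfold d; lra|].
    apply H1; assumption.
  - destruct (H1 k) as (_ & _ & _ & [r Hr]). exists r; intros x; split; intros Hx.
    + destruct (Hr x) as [[-> ->] _]; [lra|]; split; ring.
    + destruct (Hr x) as [_ [-> ->]]; [lra|]; split; ring.
  - apply Rsum_bounded_scal; [lra|assumption].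
  - apply is_lim_seq_ext with (fun n => c * Rsum i n).
    + intros n; symmetry; apply Rsum_scal.
    + apply (is_lim_seq_scal_l _ c I); assumption.
  - intros x Hx Hb.
    apply is_lim_seq_ext with (fun n => c * Rsum (fun k => u k x) n).
    + intros n; symmetry; apply Rsum_scal.
    + apply (is_lim_seq_scal_l _ c (f x)), H4; [assumption|].
      eapply Rsum_bounded_le; [|exact Hb]. intros k; simpl.
      assert (0 <= v k x) by (eapply Rle_trans; [apply Rabs_pos|apply (H1 k); exact Hx]).
      nra.
Qed.

Lemma gint_0 : gint (fun _ => 0) 0.
Proof.
  exists (fun _ => 0), (fun _ _ => 0), (fun _ _ => 0), (fun _ _ => 0), (fun _ _ => 0),
    (fun _ => 0), (fun _ => 0).
  assert (H : forall n, Rsum (fun _ => 0) n = 0).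
  { intros n; induction n as [|n IH]; simpl; lra. }
  assert (Hl : is_lim_seq (Rsum (fun _ => 0)) 0).
  { apply is_lim_seq_ext with (fun _ => 0); [intros n; symmetry; apply H|].
    apply is_lim_seq_const. }
  split; [intros k; apply gterm_intro|split; [|split]]; auto.
  - intros x; apply continuity_pt_const; intros ? ?; reflexivity.
  - intros; lra.
  - intros x _; apply is_derive_cst.
  - intros x _; apply is_derive_cst.
  - intros x _; rewrite Rabs_R0; lra.
  - exists 0; auto.
  - exists 0; intros n; rewrite H; lra.
Qed.

Lemma gint_unique (f : R -> R) (I J : R) : gint f I -> gint f J -> I = J.
Proof.
  assert (H : forall I J, gint f I -> gint f J -> I <= J).
  { clear I J; intros I J HI HJ. assert (I + (-1) * J <= 0); [|lra].
    apply gint_0_le.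
    apply (gint_ext (fun x => f x + (-1) * f x) _ _ (fun _ => 0)); [intros; ring|].
    apply gint_plus; [assumption|]. apply gint_scal; assumption. }
  intros HI HJ; apply Rle_antisym; auto.
Qed.

(** Reflection reverses orientation, so the primitive vanishing on the far left becomes
    [i k - U k (c - x)]. Two reflections make a translation. *)
Lemma gint_reflect (c : R) (f : R -> R) (I : R) :
  gint f I -> gint (fun x => f (c - x)) I.
Proof.
  intros (e & u & U & v & V & i & m & H1 & H2 & H3 & H4).
  assert (Hav : forall x, avoids (fun j => c - e j) x -> avoids e (c - x)).
  { intros x H j E; apply (H j); lra. }
  assert (Hder : forall (F : R -> R) k0 l x, is_derive F (c - x) l ->
            is_derive (fun t => k0 - F (c - t)) x l).
  { intros F k0 l x H.
    replace l with (0 - (-1) * l) by ring.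
    apply (is_derive_minus (fun _ => k0) (fun t => F (c - t))).
    - apply is_derive_cst.
    - apply (is_derive_comp F (fun t => c - t)); [exact H|].
      auto_derive; [exact Logic.I|ring]. }
  exists (fun j => c - e j), (fun k x => u k (c - x)), (fun k x => i k - U k (c - x)),
    (fun k x => v k (c - x)), (fun k x => m k - V k (c - x)), i, m.
  split; [intros k; apply gterm_intro|split; [|split]]; auto.
  - intros x. apply (continuity_pt_minus (fun _ => i k) (fun x => U k (c - x))).
    + apply continuity_pt_const; intros ? ?; reflexivity.
    + apply (continuity_pt_comp (fun x => c - x) (U k)).
      * apply continuity_pt_minus; [apply continuity_pt_const; intros ? ?; reflexivity|].
        apply continuity_pt_id.
      * apply H1.
  - intros x y Hxy. assert (V k (c - y) <= V k (c - x)) by (apply H1; lra). lra.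
  - intros x Hx; apply Hder, H1; auto.
  - intros x Hx; apply Hder, H1; auto.
  - intros x Hx; apply H1; auto.
  - destruct (H1 k) as (_ & _ & _ & [r Hr]). exists (r + Rabs c); intros x.
    pose proof (Rle_abs c). pose proof (Rle_abs (- c)). rewrite Rabs_Ropp in *.
    split; intros Hx.
    + destruct (Hr (c - x)) as [_ [-> ->]]; lra.
    + destruct (Hr (c - x)) as [[-> ->] _]; lra.
Qed.

Lemma gint_translate (c : R) (f : R -> R) (I : R) :
  gint f I -> gint (fun x => f (x - c)) I.
Proof.
  intros H. apply (gint_reflect 0) in H. apply (gint_reflect c) in H.
  apply gint_ext with (e' := fun _ => 0) (2 := H).
  intros x _; f_equal; ring.
Qed.

(** * Products with bricks *)

Lemma increment_le_lipschitz (F f : R -> R) (e : nat -> R) (A B M : R) :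
  A <= B ->
  (forall x, continuity_pt F x) ->
  (forall x, A <= x < B -> avoids e x -> is_derive F x (f x) /\ f x <= M) ->
  0 <= M -> F B - F A <= M * (B - A).
Proof.
  intros HAB HF Hf HM.
  (* A constant bound [M] is the series of primitives reduced to its first term [M * t]. *)
  set (G := fun (k : nat) (t : R) => match k with O => M * t | S _ => 0 end).
  assert (HG : forall x y n, x <= y -> Rsum (fun k => G k y - G k x) n <= M * (y - x) /\
    Rsum (fun k => G k y - G k x) 1 = M * (y - x)).
  { intros x y n Hxy. split; [|simpl; ring].
    assert (0 <= M * (y - x)) by (apply Rmult_le_pos; lra).
    induction n as [|[|n] IH]; simpl in *; lra. }
  apply (increment_le_Rsum F G e); auto.
  - intros [|k] x y Hxy; simpl; [apply Rmult_le_compat_l; lra|lra].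
  - intros x Hx Hav eta Heta. destruct (Hf x Hx Hav) as [Hd Hle].
    destruct (is_derive_increment F x (f x) eta Hd Heta) as [h0 [Hh0 Hh]].
    exists 1%nat, h0; split; [exact Hh0|]. intros h Hlt.
    destruct (HG x (x + h) O) as [_ ->]; [lra|]. specialize (Hh h Hlt).
    assert ((f x + eta) * h <= (M + eta) * h) by (apply Rmult_le_compat_r; lra). lra.
  - intros n; apply HG; exact HAB.
Qed.

Lemma increment_lipschitz (F f : R -> R) (e : nat -> R) (A B M : R) :
  A <= B ->
  (forall x, continuity_pt F x) ->
  (forall x, A <= x < B -> avoids e x -> is_derive F x (f x) /\ Rabs (f x) <= M) ->
  0 <= M -> Rabs (F B - F A) <= M * (B - A).
Proof.
  intros HAB HF Hf HM. apply Rabs_le; split.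
  - assert (- F B - - F A <= M * (B - A)); [|lra].
    apply (increment_le_lipschitz (fun x => - F x) (fun x => - f x) e); auto.
    + intros x; apply (continuity_pt_opp F); auto.
    + intros x Hx Hav; destruct (Hf x Hx Hav) as [H1 H2]. split.
      * apply (is_derive_opp F); exact H1.
      * apply Rabs_le_between in H2; lra.
  - apply (increment_le_lipschitz F f e); auto.
    intros x Hx Hav; destruct (Hf x Hx Hav) as [H1 H2]. split; [exact H1|].
    apply Rabs_le_between in H2; lra.
Qed.

(** Write [u] as [(u + v) - v]: both series have nonnegative terms and bounded partial sums. *)
Lemma ex_lim_Rsum (u v : nat -> R) :
  (forall k, Rabs (u k) <= v k) -> Rsum_bounded v ->
  exists l : R, is_lim_seq (Rsum u) l.
Proof.
  intros Huv Hv.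
  assert (Hpos : forall w, (forall k, 0 <= w k) -> Rsum_bounded w ->
            exists l : R, is_lim_seq (Rsum w) l).
  { intros w Hw [s Hs].
    destruct (ex_finite_lim_seq_incr (Rsum w) s) as [l Hl]; [|exact Hs|exists l; exact Hl].
    intros n; simpl; specialize (Hw n); lra. }
  assert (Hb : forall k, 0 <= v k /\ 0 <= u k + v k <= 2 * v k).
  { intros k; specialize (Huv k). pose proof (Rabs_pos (u k)).
    apply Rabs_le_between in Huv; lra. }
  destruct (Hpos v) as [l Hl]; [apply Hb|exact Hv|].
  destruct (Hpos (fun k => u k + v k)) as [l' Hl']; [apply Hb| |].
  - eapply Rsum_bounded_le; [|apply (Rsum_bounded_scal 2 v); [lra|exact Hv]].
    intros k; apply Hb.
  - exists (l' - l). apply is_lim_seq_ext with (fun n => Rsum (fun k => u k + v k) n - Rsum v n).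
    + intros n; rewrite Rsum_plus; ring.
    + apply is_lim_seq_minus'; assumption.
Qed.

(** Tannery's theorem: the tail of [v] controls all rows at once, and only finitely many columns
    remain. The three errors, from the leading terms, the tail and the row limit, take [eps / 4]
    each. *)
Lemma lim_Rsum_dominated (x : nat -> nat -> R) (v : nat -> R) (s : nat -> R) :
  (forall n k, Rabs (x n k) <= v k) -> Rsum_bounded v ->
  (forall k, is_lim_seq (fun n => x n k) 0) ->
  (forall n, is_lim_seq (Rsum (x n)) (s n)) ->
  is_lim_seq s 0.
Proof.
  intros Hx Hv Hl Hs. apply is_lim_seq_eps; intros eps Heps.
  destruct (Rsum_tail v) with (eps := eps / 4) as [N HN]; [|exact Hv|lra|].
  { intros k; eapply Rle_trans; [apply Rabs_pos|apply (Hx O)]. }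
  assert (HlN : is_lim_seq (fun n => Rsum (x n) N) 0).
  { clear HN; induction N as [|N IH]; simpl; [apply is_lim_seq_const|].
    replace 0 with (0 + 0) by ring. apply is_lim_seq_plus'; auto. }
  apply is_lim_seq_eps with (eps := eps / 4) in HlN; [|lra]. destruct HlN as [p Hp].
  exists p; intros n Hn. specialize (Hp n Hn).
  specialize (Hs n). apply is_lim_seq_eps with (eps := eps / 4) in Hs; [|lra].
  destruct Hs as [q Hq]. specialize (Hq (N + q)%nat ltac:(lia)).
  rewrite Rsum_app in Hq.
  assert (Rabs (Rsum (fun k => x n (N + k)%nat) q) <= eps / 4).
  { eapply Rle_trans; [apply Rsum_Rabs|]. eapply Rle_trans; [|apply (HN N q); lia].
    apply Rsum_le; intros k _; apply Hx. }
  apply Rabs_le_between in H. apply Rabs_lt_between in Hq, Hp. apply Rabs_lt_between. lra.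
Qed.

(** Projection onto [[a, b]]. If [W] is a primitive of [w], then [W] composed with [clamp a b] is
    one of [brick a b * w], except at the two corners [a] and [b]; these therefore join the
    exceptional sequence. *)
Definition clamp (a b t : R) : R := Rmax a (Rmin t b).

Lemma clamp_left a b t : a <= b -> t <= a -> clamp a b t = a.
Proof. intros; unfold clamp, Rmax, Rmin; repeat destruct Rle_dec; lra. Qed.

Lemma clamp_right a b t : a <= b -> b <= t -> clamp a b t = b.
Proof. intros; unfold clamp, Rmax, Rmin; repeat destruct Rle_dec; lra. Qed.

Lemma clamp_mid a b t : a <= t <= b -> clamp a b t = t.
Proof. intros; unfold clamp, Rmax, Rmin; repeat destruct Rle_dec; lra. Qed.

Lemma clamp_le a b s t : s <= t -> clamp a b s <= clamp a b t.
Proof. intros; unfold clamp, Rmax, Rmin; repeat destruct Rle_dec; lra. Qed.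

Lemma lipschitz_continuity (F : R -> R) x :
  (forall t, Rabs (F t - F x) <= Rabs (t - x)) -> continuity_pt F x.
Proof.
  intros H eps Heps. exists eps; split; [exact Heps|]. intros t [_ Ht].
  eapply Rle_lt_trans; [apply H|exact Ht].
Qed.

Lemma clamp_continuity a b x : continuity_pt (clamp a b) x.
Proof.
  apply lipschitz_continuity; intros t. unfold clamp, Rmax, Rmin.
  repeat destruct Rle_dec; unfold Rabs; repeat destruct Rcase_abs; lra.
Qed.

Lemma clamp_derive (F : R -> R) a b x l :
  a < b -> x <> a -> x <> b -> is_derive F x l ->
  is_derive (fun t => F (clamp a b t)) x (brick a b x * l).
Proof.
  intros Hab Ha Hb H. unfold brick.
  destruct (Rle_dec a x), (Rlt_dec x b); try lra.
  - rewrite Rmult_1_l. apply is_derive_ext_loc with F; [|exact H].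
    apply filter_imp with (fun t => a < t /\ t < b).
    + intros t Ht; rewrite clamp_mid; [reflexivity|lra].
    + apply filter_and; [apply open_gt|apply open_lt]; lra.
  - rewrite Rmult_0_l. apply is_derive_ext_loc with (fun _ => F b); [|apply is_derive_cst].
    apply filter_imp with (fun t => b < t); [|apply open_gt; lra].
    intros t Ht; rewrite clamp_right; [reflexivity|lra|lra].
  - rewrite Rmult_0_l. apply is_derive_ext_loc with (fun _ => F a); [|apply is_derive_cst].
    apply filter_imp with (fun t => t < a); [|apply open_lt; lra].
    intros t Ht; rewrite clamp_left; [reflexivity|lra|lra].
Qed.

Lemma brick_bounds a b x : 0 <= brick a b x <= 1.
Proof. unfold brick; repeat destruct Rle_dec; repeat destruct Rlt_dec; lra. Qed.

Lemma gterm_brick (e e' : nat -> R) (w W : R -> R) (lam a b M : R) :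
  a < b -> 0 <= M ->
  (forall x, avoids e' x -> avoids e x /\ x <> a /\ x <> b) ->
  (forall x, continuity_pt W x) ->
  (forall x, avoids e x -> is_derive W x (w x)) ->
  (forall x, a <= x <= b -> Rabs (w x) <= M) ->
  gterm e' (fun x => lam * brick a b x * w x) (fun x => lam * (W (clamp a b x) - W a))
    (fun x => M * (Rabs lam * brick a b x)) (fun x => M * (Rabs lam * (clamp a b x - a)))
    (lam * (W b - W a)) (M * (Rabs lam * (b - a))).
Proof.
  intros Hab HM He HW Hw Hb. apply gterm_intro.
  - intros x. apply (continuity_pt_scal (fun x => W (clamp a b x) - W a)).
    apply (continuity_pt_minus (fun x => W (clamp a b x)) (fun _ => W a)).
    + apply (continuity_pt_comp (clamp a b) W); [apply clamp_continuity|apply HW].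
    + apply continuity_pt_const; intros ? ?; reflexivity.
  - intros x y Hxy. pose proof (clamp_le a b x y Hxy). pose proof (Rabs_pos lam).
    apply Rmult_le_compat_l; [exact HM|]. apply Rmult_le_compat_l; lra.
  - intros x Hx; destruct (He x Hx) as (Hx1 & Hxa & Hxb).
    replace (lam * brick a b x * w x) with (lam * (brick a b x * w x - 0)) by ring.
    apply (is_derive_scal (fun x => W (clamp a b x) - W a)).
    apply (is_derive_minus (fun x => W (clamp a b x)) (fun _ => W a)); [|apply is_derive_cst].
    apply clamp_derive; auto.
  - intros x Hx; destruct (He x Hx) as (Hx1 & Hxa & Hxb).
    apply (is_derive_scal (fun x => Rabs lam * (clamp a b x - a))).
    apply (is_derive_scal (fun x => clamp a b x - a)).
    replace (brick a b x) with (brick a b x * 1 - 0) by ring.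
    apply (is_derive_minus (clamp a b) (fun _ => a)); [|apply is_derive_cst].
    apply (clamp_derive (fun t => t)); auto. apply (@is_derive_id R_AbsRing).
  - intros x Hx. pose proof (brick_bounds a b x).
    rewrite !Rabs_mult, (Rabs_right (brick a b x)) by lra.
    rewrite (Rmult_comm M). unfold brick in *.
    pose proof (Rabs_pos lam). pose proof (Rabs_pos (w x)).
    destruct (Rle_dec a x); [destruct (Rlt_dec x b)|]; try lra.
    rewrite Rmult_1_r. apply Rmult_le_compat_l; [lra|]. apply Hb; lra.
  - exists (Rabs a + Rabs b); intros x.
    pose proof (Rle_abs a). pose proof (Rle_abs (-a)). pose proof (Rle_abs b).
    pose proof (Rle_abs (-b)). rewrite Rabs_Ropp in *. pose proof (Rabs_pos a).
    split; intros Hx; [rewrite clamp_left by lra|rewrite clamp_right by lra]; split; ring.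
Qed.

(** What is left of [is_LInt] when the value of the integral is dropped, with absolute convergence
    put as boundedness of partial sums. *)
Definition brick_series (g : R -> R) (lam a b : nat -> R) : Prop :=
  (forall k, a k < b k) /\
  Rsum_bounded (fun k => Rabs (lam k) * (b k - a k)) /\
  (forall x, Rsum_bounded (fun k => Rabs (lam k) * brick (a k) (b k) x) ->
             is_lim_seq (Rsum (fun k => lam k * brick (a k) (b k) x)) (g x)).

Lemma series_cv_lim_Rsum (u : nat -> R) (s : R) :
  series_cv u s <-> is_lim_seq (Rsum u) s.
Proof.
  (* [sum_f_R0 u n] includes the term of index [n], while [Rsum u n] stops before it. *)
  assert (E : forall n, sum_f_R0 u n = Rsum u (S n)).
  { induction n as [|n IH]; simpl in *; [ring|rewrite IH; reflexivity]. }
  unfold series_cv. rewrite <- is_lim_seq_Reals, (is_lim_seq_incr_1 (Rsum u)).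
  split; apply is_lim_seq_ext; intros n; rewrite E; reflexivity.
Qed.

Lemma is_LInt_brick_series (g : R -> R) (I : R) :
  is_LInt g I -> exists lam a b,
    brick_series g lam a b /\ is_lim_seq (Rsum (fun k => lam k * (b k - a k))) I.
Proof.
  intros (lam & a & b & Hab & [s Hs] & HI & Hg). exists lam, a, b.
  split; [|apply series_cv_lim_Rsum; exact HI].
  split; [exact Hab|split].
  - apply series_cv_lim_Rsum in Hs. exists s; intros n.
    apply (is_lim_seq_incr_compare (Rsum (fun k => Rabs (lam k) * (b k - a k))) s Hs).
    intros p; simpl. pose proof (Rabs_pos (lam p)). specialize (Hab p).
    assert (0 <= Rabs (lam p) * (b p - a p)) by (apply Rmult_le_pos; lra). lra.
  - intros x Hb. apply series_cv_lim_Rsum, Hg.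
    destruct (ex_lim_Rsum (fun k => Rabs (lam k) * brick (a k) (b k) x) _
                (fun k => Rle_refl _)) as [l Hl].
    + eapply Rsum_bounded_le; [|exact Hb]. intros k.
      rewrite Rabs_mult, Rabs_Rabsolu, (Rabs_right (brick _ _ _)); [lra|].
      apply Rle_ge, brick_bounds.
    + exists l; apply series_cv_lim_Rsum; exact Hl.
Qed.

(** Multiplying each brick by [w] gives a term with primitive [W] composed with a clamp, which is
    the reason for allowing general primitives in [gint]. Strict positivity of [M] makes the new
    dominating series diverge wherever the old one does. *)
Lemma brick_series_mult (g : R -> R) (lam a b e : nat -> R) (w W : R -> R) (M : R) :
  brick_series g lam a b -> 0 < M ->
  (forall x, continuity_pt W x) ->
  (forall x, avoids e x -> is_derive W x (w x)) ->
  (forall k x, a k <= x <= b k -> Rabs (w x) <= M) ->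
  exists I, gint (fun x => g x * w x) I /\
            is_lim_seq (Rsum (fun k => lam k * (W (b k) - W (a k)))) I /\
            (forall k, Rabs (lam k * (W (b k) - W (a k))) <= M * (Rabs (lam k) * (b k - a k))).
Proof.
  intros (Hab & Hs & Hg) HM HW Hw Hb.
  assert (Hbd : forall k, Rabs (lam k * (W (b k) - W (a k))) <=
                          M * (Rabs (lam k) * (b k - a k))).
  { intros k. specialize (Hab k). rewrite Rabs_mult.
    replace (M * (Rabs (lam k) * (b k - a k))) with (Rabs (lam k) * (M * (b k - a k))) by ring.
    apply Rmult_le_compat_l; [apply Rabs_pos|].
    apply (increment_lipschitz W w e); [lra|exact HW| |lra].
    intros x Hx Hav; split; [auto|]. apply (Hb k); lra. }
  destruct (ex_lim_Rsum _ _ Hbd) as [I HI].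
  { apply Rsum_bounded_scal; [lra|exact Hs]. }
  exists I; split; [|split; assumption].
  exists (interleave e (interleave a b)), (fun k x => lam k * brick (a k) (b k) x * w x),
    (fun k x => lam k * (W (clamp (a k) (b k) x) - W (a k))),
    (fun k x => M * (Rabs (lam k) * brick (a k) (b k) x)),
    (fun k x => M * (Rabs (lam k) * (clamp (a k) (b k) x - a k))),
    (fun k => lam k * (W (b k) - W (a k))), (fun k => M * (Rabs (lam k) * (b k - a k))).
  split; [|split; [|split]].
  - intros k; apply (gterm_brick e); auto; [lra| |].
    + intros x Hx; apply avoids_interleave in Hx; destruct Hx as [Hx Hx'].
      apply avoids_interleave in Hx'; destruct Hx' as [Ha Hb']. auto.
    + intros x Hx; apply (Hb k); exact Hx.
  - apply Rsum_bounded_scal; [lra|exact Hs].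
  - exact HI.
  - intros x _ Hx.
    apply is_lim_seq_ext with (fun n => w x * Rsum (fun k => lam k * brick (a k) (b k) x) n).
    + intros n; rewrite <- Rsum_scal; apply Rsum_ext; intros; ring.
    + rewrite (Rmult_comm (g x)). apply (is_lim_seq_scal_l _ (w x) (g x)), Hg.
      eapply Rsum_bounded_le; [|apply (Rsum_bounded_scal (/ M)); [|exact Hx]].
      * intros k; right; field; lra.
      * left; apply Rinv_0_lt_compat; lra.
Qed.

Lemma is_LInt_gint (g : R -> R) (I : R) : is_LInt g I -> gint g I.
Proof.
  intros H; destruct (is_LInt_brick_series g I H) as (lam & a & b & Hs & Hl).
  destruct (brick_series_mult g lam a b (fun _ => 0) (fun _ => 1) (fun x => x) 1 Hs)
    as (J & HJ & Hl' & _); [lra| | | |].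
  - intros x; apply continuity_pt_id.
  - intros x _; apply (@is_derive_id R_AbsRing).
  - intros; rewrite Rabs_R1; lra.
  - replace I with J.
    + apply gint_ext with (2 := HJ) (e' := fun _ => 0); intros; ring.
    + apply is_lim_seq_unique in Hl, Hl'. congruence.
Qed.

(* Riemann-Lebesgue: integrable functions need only be tested on their bricks. *)
Lemma is_LInt_mult_lim_0 (g : R -> R) (I : R) (e : nat -> R) (w W : nat -> R -> R) (M : R) :
  is_LInt g I -> 0 < M ->
  (forall n x, continuity_pt (W n) x) ->
  (forall n x, avoids e x -> is_derive (W n) x (w n x)) ->
  (forall n x, Rabs (w n x) <= M) ->
  (forall a b, a < b -> is_lim_seq (fun n => W n b - W n a) 0) ->
  exists J : nat -> R, (forall n, gint (fun x => g x * w n x) (J n)) /\ is_lim_seq J 0.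
Proof.
  intros H HM HW Hw Hb Hl; destruct (is_LInt_brick_series g I H) as (lam & a & b & Hs & _).
  destruct (functional_choice _ _ (fun n J => gint (fun x => g x * w n x) J /\
     is_lim_seq (Rsum (fun k => lam k * (W n (b k) - W n (a k)))) J /\
     (forall k, Rabs (lam k * (W n (b k) - W n (a k))) <= M * (Rabs (lam k) * (b k - a k)))))
    as [J HJ].
  { intros n; apply (brick_series_mult g lam a b e); auto. }
  exists J; split; [intros n; apply HJ|].
  apply (lim_Rsum_dominated (fun n k => lam k * (W n (b k) - W n (a k)))
           (fun k => M * (Rabs (lam k) * (b k - a k)))).
  - intros n; apply HJ.
  - apply Rsum_bounded_scal; [lra|apply Hs].
  - intros k. replace (Finite 0) with (Rbar_mult (lam k) 0) by (simpl; f_equal; ring).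
    apply is_lim_seq_scal_l, Hl, Hs.
  - intros n; apply HJ.
Qed.

Lemma gint_brick (a b : R) (e : nat -> R) (w W : R -> R) (M : R) :
  a < b -> 0 < M ->
  (forall x, continuity_pt W x) ->
  (forall x, avoids e x -> is_derive W x (w x)) ->
  (forall x, a <= x <= b -> Rabs (w x) <= M) ->
  gint (fun x => brick a b x * w x) (W b - W a).
Proof.
  intros Hab HM HW Hw Hb.
  (* One brick as a series: the coefficients vanish after the first, but the bricks are repeated,
     since each must have [a k < b k]. *)
  set (lam := fun k : nat => match k with O => 1 | S _ => 0 end).
  assert (Hlam : forall c n, Rsum (fun k => lam k * c) (S n) = c).
  { intros c n; induction n as [|n IH]; simpl in *; lra. }
  assert (Hlim : forall c, is_lim_seq (Rsum (fun k => lam k * c)) c).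
  { intros c; apply is_lim_seq_incr_1. apply is_lim_seq_ext with (fun _ => c);
      [intros n; symmetry; apply Hlam|apply is_lim_seq_const]. }
  destruct (brick_series_mult (brick a b) lam (fun _ => a) (fun _ => b) e w W M)
    as (J & HJ & Hl & _); auto.
  - split; [auto|split; [|intros x _; apply Hlim]].
    exists (b - a); intros n. apply Rle_trans with (Rsum (fun k => lam k * (b - a)) (S n)).
    + simpl. rewrite (Rsum_ext (fun k => Rabs (lam k) * (b - a)) (fun k => lam k * (b - a))).
      * assert (0 <= lam n * (b - a)) by (unfold lam; destruct n; lra). lra.
      * intros k _. unfold lam; destruct k; rewrite ?Rabs_R1, ?Rabs_R0; ring.
    + rewrite Hlam; lra.
  - replace (W b - W a) with J; [exact HJ|].
    pose proof (Hlim (W b - W a)) as Hl'. apply is_lim_seq_unique in Hl, Hl'. congruence.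
Qed.

(** * Oscillatory integrals *)

Lemma derive_bound (F f : R -> R) (a b K : R) :
  a <= b -> 0 <= K ->
  (forall x, a <= x <= b -> continuity_pt F x) ->
  (forall x, a < x < b -> is_derive F x (f x) /\ Rabs (f x) <= K) ->
  Rabs (F b - F a) <= K * (b - a).
Proof.
  intros Hab HK Hc Hf.
  (* The mean value point may be an end point, where nothing is known of [f]; the value 0 there
     respects the bound because [0 <= K]. *)
  set (g := fun x => if Rlt_dec a x then (if Rlt_dec x b then f x else 0) else 0).
  destruct (MVT_gen F a b g) as [c [_ ->]];
    rewrite ?Rmin_left, ?Rmax_right in * by exact Hab; auto.
  - intros x Hx. unfold g. destruct (Rlt_dec a x), (Rlt_dec x b); try lra. apply Hf; exact Hx.
  - rewrite Rabs_mult, (Rabs_right (b - a)) by lra.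
    apply Rmult_le_compat_r; [lra|]. unfold g.
    destruct (Rlt_dec a c), (Rlt_dec c b); rewrite ?Rabs_R0; try exact HK.
    apply Hf; lra.
Qed.

Lemma derive_nonneg (F f : R -> R) (a b : R) :
  a <= b ->
  (forall x, a <= x <= b -> is_derive F x (f x) /\ 0 <= f x) -> F a <= F b.
Proof.
  intros Hab Hf.
  destruct (MVT_gen F a b f) as [c [Hc E]];
    rewrite ?Rmin_left, ?Rmax_right in * by exact Hab.
  - intros x Hx; apply Hf; lra.
  - intros x Hx. apply derivable_continuous_pt. exists (f x). apply is_derive_Reals, Hf; lra.
  - assert (0 <= f c * (b - a)); [|lra]. apply Rmult_le_pos; [apply Hf; lra|lra].
Qed.

Lemma is_derive_continuity (F : R -> R) x l : is_derive F x l -> continuity_pt F x.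
Proof.
  intros H; apply derivable_continuous_pt. exists l. apply is_derive_Reals; exact H.
Qed.

(* Integration by parts, with [Q] a primitive of the oscillating integrand. *)
Lemma oscillatory_bound (Q psi psi1 psi2 rho rho1 : R -> R) (a b m M R0 R1 : R) :
  a <= b -> 0 < m -> 0 <= M -> 0 <= R0 -> 0 <= R1 ->
  (forall x, a <= x <= b ->
     is_derive Q x (sin (psi x) * rho x) /\ is_derive psi x (psi1 x) /\
     is_derive psi1 x (psi2 x) /\ is_derive rho x (rho1 x)) ->
  (forall x, a <= x <= b ->
     m <= psi1 x /\ Rabs (psi2 x) <= M * psi1 x /\ Rabs (rho x) <= R0 /\ Rabs (rho1 x) <= R1) ->
  Rabs (Q b - Q a) <= (2 * R0 + (b - a) * (R1 + R0 * M)) / m.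
Proof.
  intros Hab Hm HM HR0 HR1 Hd Hb.
  (* The integrand is [(psi1 * sin psi) * (rho / psi1)], so [- F] is the boundary term and [Q + F]
     has derivative [cos psi] times the derivative of [rho / psi1], which is of order [1 / m]. *)
  set (F := fun x => cos (psi x) * rho x / psi1 x).
  set (H := fun x => Q x + F x).
  set (h := fun x => cos (psi x) * ((rho1 x - rho x * (psi2 x / psi1 x)) / psi1 x)).
  assert (Hh : forall x, a <= x <= b -> is_derive H x (h x)).
  { intros x Hx. destruct (Hd x Hx) as (d1 & d2 & d3 & d4). destruct (Hb x Hx) as (b1 & _).
    assert (Hne : psi1 x <> 0) by lra.
    unfold H, F, h.
    pose proof (is_derive_unique _ _ _ d1) as e1. pose proof (is_derive_unique _ _ _ d2) as e2.
    pose proof (is_derive_unique _ _ _ d3) as e3. pose proof (is_derive_unique _ _ _ d4) as e4.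
    auto_derive.
    - split; [exists (sin (psi x) * rho x); exact d1|].
      split; [exists (psi1 x); exact d2|].
      split; [exists (rho1 x); exact d4|].
      split; [exists (psi2 x); exact d3|split; [exact Hne|exact Logic.I]].
    - replace (Derive (fun x => Q x) x) with (sin (psi x) * rho x) by (symmetry; exact e1).
      replace (Derive (fun x => psi x) x) with (psi1 x) by (symmetry; exact e2).
      replace (Derive (fun x => rho x) x) with (rho1 x) by (symmetry; exact e4).
      replace (Derive (fun x => psi1 x) x) with (psi2 x) by (symmetry; exact e3).
      field; exact Hne. }
  assert (Hinv : forall x, a <= x <= b -> 0 < / psi1 x <= / m).
  { intros x Hx; destruct (Hb x Hx) as (b1 & _). split.
    - apply Rinv_0_lt_compat; lra.
    - apply Rinv_le_contravar; lra. }
  assert (Hcos : forall x, Rabs (cos x) <= 1).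
  { intros x; apply Rabs_le, COS_bound. }
  assert (HF : forall x, a <= x <= b -> Rabs (F x) <= R0 * / m).
  { intros x Hx; destruct (Hb x Hx) as (b1 & b2 & b3 & b4); pose proof (Hinv x Hx).
    unfold F, Rdiv. rewrite !Rabs_mult, (Rabs_right (/ psi1 x)) by lra.
    apply Rmult_le_compat; try lra.
    - apply Rmult_le_pos; apply Rabs_pos.
    - rewrite <- (Rmult_1_l R0). apply Rmult_le_compat; try apply Rabs_pos; auto. }
  assert (HH : Rabs (H b - H a) <= ((R1 + R0 * M) * / m) * (b - a)).
  { apply (derive_bound H h); [exact Hab| | |].
    - apply Rmult_le_pos; [|left; apply Rinv_0_lt_compat; lra].
      pose proof (Rmult_le_pos _ _ HR0 HM); lra.
    - intros x Hx; apply (is_derive_continuity _ _ _ (Hh x Hx)).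
    - intros x Hx; split; [apply Hh; lra|].
      destruct (Hb x) as (b1 & b2 & b3 & b4); [lra|]. pose proof (Hinv x ltac:(lra)).
      unfold h. rewrite Rabs_mult, <- (Rmult_1_l ((R1 + R0 * M) * / m)).
      apply Rmult_le_compat; try apply Rabs_pos; [apply Hcos|].
      unfold Rdiv at 1. rewrite Rabs_mult, (Rabs_right (/ psi1 x)) by lra.
      apply Rmult_le_compat; try apply Rabs_pos; try lra.
      unfold Rminus; eapply Rle_trans; [apply Rabs_triang|].
      rewrite Rabs_Ropp, Rabs_mult. apply Rplus_le_compat; [exact b4|].
      apply Rmult_le_compat; try apply Rabs_pos; [exact b3|].
      unfold Rdiv; rewrite Rabs_mult, (Rabs_right (/ psi1 x)) by lra.
      apply Rmult_le_reg_r with (psi1 x); [lra|].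
      rewrite Rmult_assoc, Rinv_l, Rmult_1_r by lra. exact b2. }
  pose proof (HF a ltac:(lra)) as Ha. pose proof (HF b ltac:(lra)) as Hb'.
  replace (Q b - Q a) with ((H b - H a) - F b + F a) by (unfold H; ring).
  apply Rabs_le_between in Ha, Hb', HH. apply Rabs_le_between.
  replace ((2 * R0 + (b - a) * (R1 + R0 * M)) / m)
    with ((R1 + R0 * M) * / m * (b - a) + R0 * / m + R0 * / m) by (unfold Rdiv; ring).
  lra.
Qed.

Definition slope (g : R -> R) (x0 d t : R) : R :=
  if Req_dec_T t x0 then d else (g t - g x0) / (t - x0).

Lemma slope_neq g x0 d t : t <> x0 -> slope g x0 d t = (g t - g x0) / (t - x0).
Proof. intros H; unfold slope; destruct Req_dec_T; tauto. Qed.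

Lemma slope_continuity (g : R -> R) x0 d :
  (forall x, continuity_pt g x) -> is_derive g x0 d ->
  forall x, continuity_pt (slope g x0 d) x.
Proof.
  intros Hg Hd x. destruct (Req_dec_T x x0) as [->|Hne].
  - apply is_derive_Reals in Hd. intros eps Heps.
    destruct (Hd eps Heps) as [del Hdel]. exists del; split; [apply cond_pos|].
    intros t [[_ Hne] Ht]. simpl in *; unfold Rdist in *.
    specialize (Hdel (t - x0) ltac:(lra) Ht).
    replace (x0 + (t - x0)) with t in Hdel by ring.
    rewrite slope_neq by auto. unfold slope; destruct Req_dec_T; [exact Hdel|tauto].
  - apply continuity_pt_ext_loc with (fun t => (g t - g x0) / (t - x0)).
    + assert (Hp : 0 < Rabs (x - x0)) by (apply Rabs_pos_lt; lra).
      exists (mkposreal _ Hp). intros t Ht. rewrite slope_neq; [reflexivity|].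
      intros ->. unfold ball in Ht; simpl in Ht; unfold AbsRing_ball, abs, minus, plus, opp in Ht;
        simpl in Ht. replace (x0 + - x) with (- (x - x0)) in Ht by ring.
      rewrite Rabs_Ropp in Ht. lra.
    + apply (continuity_pt_div (fun t => g t - g x0) (fun t => t - x0)); [| |lra].
      * apply (continuity_pt_minus g (fun _ => g x0)); [apply Hg|].
        apply continuity_pt_const; intros ? ?; reflexivity.
      * apply (continuity_pt_minus (fun t => t) (fun _ => x0)); [apply continuity_pt_id|].
        apply continuity_pt_const; intros ? ?; reflexivity.
Qed.

Lemma RInt_primitive (f : R -> R) c t :
  (forall x, continuity_pt f x) -> is_derive (fun t => RInt f c t) t (f t).
Proof.
  intros Hf. assert (Hc : forall x, continuous f x).
  { intros x; apply continuity_pt_filterlim, Hf. }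
  apply is_derive_RInt with c; [|apply Hc].
  exists (mkposreal 1 Rlt_0_1); intros y _. apply RInt_correct.
  apply (ex_RInt_continuous (V := R_CompleteNormedModule)). intros; apply Hc.
Qed.

Definition Si (x : R) : R := RInt (slope sin 0 1) 0 x.

Lemma Si_derive x : is_derive Si x (slope sin 0 1 x).
Proof.
  apply RInt_primitive. apply slope_continuity.
  - intros t; apply continuity_sin.
  - replace 1 with (cos 0) by apply cos_0. apply is_derive_Reals, derivable_pt_lim_sin.
Qed.

Lemma Si_derive_neq x : x <> 0 -> is_derive Si x (sin x / x).
Proof.
  intros H. pose proof (Si_derive x) as Hd. rewrite slope_neq in Hd by exact H.
  rewrite sin_0, !Rminus_0_r in Hd. exact Hd.
Qed.

Lemma Si_0 : Si 0 = 0.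
Proof. apply (RInt_point (V := R_CompleteNormedModule)). Qed.

Lemma Rabs_sin_le x : Rabs (sin x) <= 1.
Proof. apply Rabs_le, SIN_bound. Qed.

(** This is [1 / sin y - 1 / y <= 1] with denominators cleared. The function [y sin y - y + sin y]
    vanishes at 0 and is nondecreasing, as [sin + cos >= 1] on the first quadrant. *)
Lemma sin_lower_bound y : 0 <= y <= PI / 2 -> y - sin y <= y * sin y.
Proof.
  intros Hy.
  assert (H : 0 * sin 0 - 0 + sin 0 <= y * sin y - y + sin y); [|rewrite sin_0 in H; lra].
  apply (derive_nonneg (fun y => y * sin y - y + sin y)
           (fun y => sin y + y * cos y - 1 + cos y)); [lra|].
  intros x Hx; split; [auto_derive; [exact Logic.I|ring]|].
  pose proof PI_RGT_0.
  assert (0 <= sin x) by (apply sin_ge_0; lra).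
  assert (0 <= cos x) by (apply cos_ge_0; lra).
  pose proof (sin2_cos2 x); unfold Rsqr in *.
  assert (0 <= x * cos x) by (apply Rmult_le_pos; lra).
  assert (1 <= sin x + cos x); [|lra]. nra.
Qed.

Lemma dirichlet_kernel_sin n y :
  sin y * (1 + 2 * Rsum (fun k => cos (2 * INR (S k) * y)) n) = sin ((2 * INR n + 1) * y).
Proof.
  induction n as [|n IH].
  - simpl. replace ((2 * 0 + 1) * y) with y by ring. ring.
  - cbn [Rsum].
    replace (sin y * (1 + 2 * (Rsum (fun k => cos (2 * INR (S k) * y)) n + cos (2 * INR (S n) * y))))
      with (sin y * (1 + 2 * Rsum (fun k => cos (2 * INR (S k) * y)) n)
            + 2 * sin y * cos (2 * INR (S n) * y)) by ring.
    rewrite IH.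
    replace ((2 * INR n + 1) * y) with (2 * INR (S n) * y - y) by (rewrite S_INR; ring).
    replace ((2 * INR (S n) + 1) * y) with (2 * INR (S n) * y + y) by ring.
    rewrite sin_minus, sin_plus. ring.
Qed.

(** The Dirichlet kernel [sin ((2n+1) y) / sin y] has the explicit primitive [P n], whose sine terms
    all vanish at [PI / 2]. Replacing [sin y] by [y] turns it into [Si ((2n+1) y)]. The difference
    [Q n] integrates a fast sine against [rho], which stays bounded up to 0, so its value at
    [PI / 2] tends to 0. *)
Lemma Si_odd_lim : is_lim_seq (fun n => Si ((2 * INR n + 1) * (PI / 2))) (PI / 2).
Proof.
  set (P := fun n y => y + Rsum (fun k => sin (2 * INR (S k) * y) / INR (S k)) n).
  assert (HS : forall k, INR (S k) <> 0) by (intros k; apply not_0_INR; lia).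
  assert (HP : forall n y, is_derive (P n) y (1 + 2 * Rsum (fun k => cos (2 * INR (S k) * y)) n)).
  { intros n y. apply (is_derive_plus (fun y => y)
      (fun y => Rsum (fun k => sin (2 * INR (S k) * y) / INR (S k)) n)).
    - apply (@is_derive_id R_AbsRing).
    - rewrite <- Rsum_scal.
      apply (Rsum_derive (fun k y => sin (2 * INR (S k) * y) / INR (S k))).
      intros k; auto_derive; [exact Logic.I|]. change (match k with 0%nat => 1 | S _ => INR k + 1 end) with (INR (S k)).
      field; apply HS. }
  assert (HPpi : forall n, P n (PI / 2) = PI / 2).
  { intros n; unfold P. rewrite (Rsum_ext _ (fun k => 0 * 0)); [rewrite Rsum_scal; ring|].
    intros k _. replace (2 * INR (S k) * (PI / 2)) with (INR (S k) * PI) by field.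
    rewrite INR_IZR_INZ, sin_eq_0_1; [unfold Rdiv; ring|]. eexists; reflexivity. }
  pose proof PI_RGT_0 as Hpi.
  set (Q := fun n y => P n y - Si ((2 * INR n + 1) * y)).
  set (rho := fun y => / sin y - / y).
  assert (HQ0 : forall n y, is_derive (Q n) y
     (1 + 2 * Rsum (fun k => cos (2 * INR (S k) * y)) n -
      (2 * INR n + 1) * slope sin 0 1 ((2 * INR n + 1) * y))).
  { intros n y. apply (is_derive_minus (P n) (fun y => Si ((2 * INR n + 1) * y))); [apply HP|].
    apply (is_derive_comp Si (fun y => (2 * INR n + 1) * y)); [apply Si_derive|].
    auto_derive; [exact Logic.I|ring]. }
  assert (HQ : forall n y, 0 < y <= PI / 2 ->
     is_derive (Q n) y (sin ((2 * INR n + 1) * y) * rho y)).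
  { intros n y Hy. pose proof (pos_INR n).
    assert (Hs : 0 < sin y) by (apply sin_gt_0; lra).
    assert (HN : (2 * INR n + 1) * y <> 0) by (apply Rmult_integral_contrapositive; lra).
    pose proof (HQ0 n y) as Hd. rewrite slope_neq, sin_0, !Rminus_0_r in Hd by exact HN.
    replace (sin ((2 * INR n + 1) * y) * rho y) with
      (1 + 2 * Rsum (fun k => cos (2 * INR (S k) * y)) n -
       (2 * INR n + 1) * (sin ((2 * INR n + 1) * y) / ((2 * INR n + 1) * y))); [exact Hd|].
    unfold rho. rewrite <- (dirichlet_kernel_sin n y).
    field. repeat split; lra. }
  assert (Hrho : forall y, 0 < y <= PI / 2 -> Rabs (rho y) <= 1).
  { intros y Hy. assert (Hs : 0 < sin y) by (apply sin_gt_0; lra).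
    assert (sin y < y) by (apply sin_lt_x; lra).
    pose proof (sin_lower_bound y ltac:(lra)).
    replace (rho y) with ((y - sin y) / (y * sin y)) by (unfold rho; field; lra).
    assert (0 < y * sin y) by (apply Rmult_lt_0_compat; lra).
    rewrite Rabs_right.
    - apply Rle_div_l; lra.
    - apply Rle_ge, Rdiv_le_0_compat; lra. }
  apply is_lim_seq_eps; intros eps Heps.
  (* On [[0, ep]] the bound [|rho| <= 1] costs at most [eps / 2]; on [[ep, PI / 2]] the derivative
     of [rho] is bounded by [R1] and the oscillation is used. *)
  set (ep := Rmin (eps / 2) (PI / 2)).
  assert (Hep : 0 < ep <= PI / 2).
  { split; [apply Rmin_glb_lt; lra|apply Rmin_r]. }
  assert (Hep' : ep <= eps / 2) by apply Rmin_l.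
  assert (Hse : 0 < sin ep) by (apply sin_gt_0; lra).
  set (R1 := / (sin ep * sin ep) + / (ep * ep)).
  assert (HR1 : 0 <= R1).
  { unfold R1; apply Rplus_le_le_0_compat; left; apply Rinv_0_lt_compat, Rmult_lt_0_compat; lra. }
  set (K := 2 * 1 + (PI / 2 - ep) * (R1 + 1 * 0)).
  assert (HK : 0 <= K).
  { unfold K. assert (0 <= (PI / 2 - ep) * (R1 + 1 * 0)) by (apply Rmult_le_pos; lra). lra. }
  destruct (nfloor_ex (2 * K / eps)) as [N [_ HN]]; [apply Rdiv_le_0_compat; lra|].
  exists (S N); intros n Hn.
  assert (Hn' : 2 * K / eps < INR n).
  { eapply Rlt_le_trans; [exact HN|]. rewrite <- S_INR. apply le_INR; lia. }
  assert (0 <= 2 * K / eps) by (apply Rdiv_le_0_compat; lra).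
  assert (H1 : Rabs (Q n ep - Q n 0) <= 1 * (ep - 0)).
  { apply (derive_bound (Q n) (fun y => sin ((2 * INR n + 1) * y) * rho y)); try lra.
    - intros x Hx. apply (is_derive_continuity _ _ _ (HQ0 n x)).
    - intros x Hx; split; [apply HQ; lra|].
      rewrite Rabs_mult, <- (Rmult_1_l 1).
      apply Rmult_le_compat; try apply Rabs_pos; [apply Rabs_sin_le|apply Hrho; lra]. }
  assert (H2 : Rabs (Q n (PI / 2) - Q n ep) <= K / (2 * INR n + 1)).
  { apply (oscillatory_bound (Q n) (fun y => (2 * INR n + 1) * y) (fun _ => 2 * INR n + 1)
      (fun _ => 0) rho (fun y => - cos y / (sin y * sin y) + / (y * y))); try lra.
    - intros x Hx. split; [apply HQ; lra|split; [|split]].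
      + auto_derive; [exact Logic.I|ring].
      + apply is_derive_cst.
      + assert (Hs : 0 < sin x) by (apply sin_gt_0; lra).
        unfold rho; auto_derive; [repeat split; lra|field; lra].
    - intros x Hx. split; [lra|split; [rewrite Rabs_R0; lra|split; [apply Hrho; lra|]]].
      assert (Hs : sin ep <= sin x) by (apply sin_incr_1; lra).
      eapply Rle_trans; [apply Rabs_triang|]. unfold R1. apply Rplus_le_compat.
      + unfold Rdiv. rewrite Rabs_mult, Rabs_Ropp, <- (Rmult_1_l (/ (sin ep * sin ep))).
        apply Rmult_le_compat; try apply Rabs_pos; [apply Rabs_le, COS_bound|].
        rewrite Rabs_right.
        * apply Rinv_le_contravar; [nra|nra].
        * apply Rle_ge; left; apply Rinv_0_lt_compat; nra.
      + rewrite Rabs_right.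
        * apply Rinv_le_contravar; nra.
        * apply Rle_ge; left; apply Rinv_0_lt_compat; nra. }
  assert (HQz : Q n 0 = 0).
  { unfold Q, P. rewrite Rmult_0_r, Si_0, (Rsum_ext _ (fun k => 0 * 0)).
    - rewrite Rsum_scal; ring.
    - intros k _. rewrite Rmult_0_r, sin_0. unfold Rdiv; ring. }
  assert (H3 : K / (2 * INR n + 1) < eps / 2).
  { apply Rlt_div_l; [lra|].
    apply Rlt_le_trans with (eps / 2 * (2 * K / eps + 1)).
    - replace (eps / 2 * (2 * K / eps + 1)) with (K + eps / 2) by (field; lra). lra.
    - apply Rmult_le_compat_l; lra. }
  replace (Si ((2 * INR n + 1) * (PI / 2)) - PI / 2) with (- Q n (PI / 2))
    by (unfold Q; rewrite HPpi; ring).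
  rewrite Rabs_Ropp. apply Rabs_le_between in H1, H2. apply Rabs_lt_between. lra.
Qed.

(** Every large [x] lies within [PI / 2] of an odd multiple [z] of [PI / 2], and between the two the
    integrand [sin y / y] is at most [2 / x] in absolute value. *)
Lemma Si_lim eps : 0 < eps -> exists X, 0 < X /\ forall x, X <= x -> Rabs (Si x - PI / 2) < eps.
Proof.
  intros Heps. pose proof PI_RGT_0 as Hpi.
  pose proof Si_odd_lim as Hl. apply is_lim_seq_eps with (eps := eps / 2) in Hl; [|lra].
  destruct Hl as [N HN].
  (* The three terms ensure in turn [x / 2 <= x - PI / 2], [PI / x < eps / 2] and [N <= n] for the
     [n] with [n PI <= x < (n + 1) PI]. *)
  set (X := PI + 2 * PI / eps + (INR N + 1) * PI).
  assert (0 < 2 * PI / eps) by (apply Rdiv_lt_0_compat; lra).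
  assert (0 <= (INR N + 1) * PI) by (pose proof (pos_INR N); apply Rmult_le_pos; lra).
  exists X; split; [unfold X; lra|]. intros x Hx.
  assert (Hx0 : 0 <= x / PI) by (apply Rdiv_le_0_compat; unfold X in Hx; lra).
  destruct (nfloor_ex (x / PI) Hx0) as [n [Hn1 Hn2]].
  assert (E : x = x / PI * PI) by (field; lra).
  assert (INR n * PI <= x) by (rewrite E; apply Rmult_le_compat_r; lra).
  assert (x < (INR n + 1) * PI) by (rewrite E at 1; apply Rmult_lt_compat_r; lra).
  assert (HnN : (N <= n)%nat).
  { apply INR_le. apply Rmult_le_reg_r with PI; [lra|]. unfold X in Hx; lra. }
  specialize (HN n HnN).
  set (z := (2 * INR n + 1) * (PI / 2)) in *.
  assert (Hz : x - PI / 2 <= z <= x + PI / 2) by (unfold z; lra).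
  assert (Hb : forall y, x / 2 <= y -> Rabs (sin y / y) <= 2 / x).
  { intros y Hy. assert (0 < x) by (unfold X in Hx; lra).
    unfold Rdiv. rewrite Rabs_mult, (Rabs_right (/ y)).
    - replace (2 * / x) with (1 * / (x / 2)) by (field; lra).
      apply Rmult_le_compat; [apply Rabs_pos| |apply Rabs_sin_le|].
      + left; apply Rinv_0_lt_compat; lra.
      + apply Rinv_le_contravar; lra.
    - apply Rle_ge; left; apply Rinv_0_lt_compat; lra. }
  assert (Hx2 : x / 2 <= x - PI / 2) by (unfold X in Hx; lra).
  assert (Hxp : 0 < x) by (unfold X in Hx; lra).
  assert (H2x : 0 <= 2 / x) by (apply Rdiv_le_0_compat; lra).
  assert (Hd : Rabs (Si x - Si z) <= 2 / x * (PI / 2)).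
  { destruct (Rle_dec z x).
    - eapply Rle_trans; [apply (derive_bound Si (fun y => sin y / y) z x (2 / x)); auto|].
      + intros y Hy; apply (is_derive_continuity _ _ _ (Si_derive y)).
      + intros y Hy; split; [apply Si_derive_neq; lra|apply Hb; lra].
      + apply Rmult_le_compat_l; lra.
    - rewrite Rabs_minus_sym.
      eapply Rle_trans; [apply (derive_bound Si (fun y => sin y / y) x z (2 / x)); auto; try lra|].
      + intros y Hy; apply (is_derive_continuity _ _ _ (Si_derive y)).
      + intros y Hy; split; [apply Si_derive_neq; lra|apply Hb; lra].
      + apply Rmult_le_compat_l; lra. }
  assert (2 / x * (PI / 2) < eps / 2).
  { replace (2 / x * (PI / 2)) with (PI / x) by (field; lra).
    apply Rlt_div_l; [lra|].
    apply Rlt_le_trans with (eps / 2 * (2 * PI / eps + PI)).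
    - replace (eps / 2 * (2 * PI / eps + PI)) with (PI + eps / 2 * PI) by (field; lra).
      assert (0 < eps / 2 * PI) by (apply Rmult_lt_0_compat; lra). lra.
    - apply Rmult_le_compat_l; unfold X in Hx; lra. }
  apply Rabs_lt_between in HN. apply Rabs_le_between in Hd. apply Rabs_lt_between. lra.
Qed.

(* Near [0] the integrand [sin (u y) / y] differs from the derivative of [Si (u y)] by at
   most [M]; away from [0] it oscillates. *)
Lemma dirichlet_phase (Q u u1 u2 : nat -> R -> R) (delta M : R) (c : nat -> R) :
  0 < delta -> 0 <= M ->
  (forall n y, 0 <= y <= delta ->
     is_derive (u n) y (u1 n y) /\ is_derive (u1 n) y (u2 n y) /\
     c n <= u1 n y /\ Rabs (u2 n y) <= M * u1 n y) ->
  (forall n, u n 0 = 0) ->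
  is_lim_seq c p_infty ->
  (forall n y, 0 <= y <= delta -> continuity_pt (Q n) y) ->
  (forall n y, 0 < y <= delta -> is_derive (Q n) y (sin (u n y) / y)) ->
  (forall n, Q n 0 = 0) ->
  is_lim_seq (fun n => Q n delta) (PI / 2).
Proof.
  intros Hdel HM Hu Hu0 Hc HQc HQ HQ0.
  apply is_lim_seq_eps; intros eps Heps.
  set (ep := Rmin delta (eps / (4 * (M + 1)))).
  assert (Hq : 0 < eps / (4 * (M + 1))) by (apply Rdiv_lt_0_compat; lra).
  assert (Hep : 0 < ep <= delta) by (split; [apply Rmin_glb_lt; lra|apply Rmin_l]).
  assert (HMep : M * ep <= eps / 4).
  { apply Rle_trans with ((M + 1) * (eps / (4 * (M + 1)))); [|right; field; lra].
    apply Rmult_le_compat; try lra. apply Rmin_r. }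
  destruct (Si_lim (eps / 4)) as [X [HX HSi]]; [lra|].
  (* The numerator of [oscillatory_bound] on [[ep, delta]] for the amplitude [1 / y], with
     [R0 = 1 / ep] and [R1 = 1 / ep^2]. *)
  set (K := 2 * / ep + (delta - ep) * (/ (ep * ep) + / ep * M)).
  assert (Hie : 0 < / ep) by (apply Rinv_0_lt_compat; lra).
  assert (Hie2 : 0 < / (ep * ep)) by (apply Rinv_0_lt_compat, Rmult_lt_0_compat; lra).
  assert (HK : 0 <= K).
  { unfold K. apply Rplus_le_le_0_compat; [lra|]. apply Rmult_le_pos; [lra|].
    assert (0 <= / ep * M) by (apply Rmult_le_pos; lra). lra. }
  apply is_lim_seq_spec in Hc.
  (* The first term brings [u n ep] beyond [X], where [Si] is close to [PI / 2]; the second makes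
     [K / c n] smaller than [eps / 4]. *)
  destruct (Hc (X / ep + 4 * K / eps)) as [N HN].
  exists N; intros n Hn. specialize (HN n Hn). simpl in HN.
  assert (0 < X / ep) by (apply Rdiv_lt_0_compat; lra).
  assert (0 <= 4 * K / eps) by (apply Rdiv_le_0_compat; lra).
  assert (Hlow : forall y, 0 <= y <= delta -> c n * y <= u n y).
  { intros y Hy. assert (Hzz : u n 0 - c n * 0 <= u n y - c n * y); [|rewrite Hu0 in Hzz; lra].
    apply (derive_nonneg (fun t => u n t - c n * t) (fun t => u1 n t - c n)); [lra|].
    intros x Hx. destruct (Hu n x) as (d1 & d2 & b1 & b2); [lra|]. split; [|lra].
    apply (is_derive_minus (u n) (fun t => c n * t)); [exact d1|].
    auto_derive; [exact Logic.I|ring]. }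
  (* The sign [s] gives both halves of [|u - y u1| <= M y u]. The difference of the two sides
     vanishes at 0 and has derivative [M u + y (M u1 + s u2)], nonnegative by the bound on [u2]. *)
  assert (Hdiff : forall s y, (s = 1 \/ s = -1) -> 0 <= y <= delta ->
            s * (u n y - y * u1 n y) <= M * y * u n y).
  { intros s y Hs Hy.
    assert (Hzz : M * 0 * u n 0 - s * (u n 0 - 0 * u1 n 0) <=
                 M * y * u n y - s * (u n y - y * u1 n y)); [|rewrite Hu0 in Hzz; lra].
    apply (derive_nonneg (fun t => M * t * u n t - s * (u n t - t * u1 n t))
             (fun t => M * (u n t + t * u1 n t) + s * (t * u2 n t))); [lra|].
    intros x Hx. destruct (Hu n x) as (d1 & d2 & b1 & b2); [lra|]. split.
    - pose proof (is_derive_unique _ _ _ d1) as e1. pose proof (is_derive_unique _ _ _ d2) as e2.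
      auto_derive.
      + repeat match goal with |- _ /\ _ => split end;
          solve [exact Logic.I | exists (u1 n x); exact d1 | exists (u2 n x); exact d2].
      + replace (Derive (fun x => u n x) x) with (u1 n x) by (symmetry; exact e1).
        replace (Derive (fun x => u1 n x) x) with (u2 n x) by (symmetry; exact e2). ring.
    - assert (0 <= u n x).
      { eapply Rle_trans; [|apply Hlow; lra]. apply Rmult_le_pos; lra. }
      apply Rabs_le_between in b2.
      assert (0 <= M * u n x) by (apply Rmult_le_pos; lra).
      assert (0 <= x * (M * u1 n x + s * u2 n x)); [|lra].
      apply Rmult_le_pos; [lra|]. destruct Hs as [-> | ->]; lra. }
  assert (H1 : Rabs ((Q n ep - Si (u n ep)) - (Q n 0 - Si (u n 0))) <= M * (ep - 0)).
  { apply (derive_bound (fun y => Q n y - Si (u n y))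
             (fun y => sin (u n y) / y - u1 n y * (sin (u n y) / u n y))); [lra|exact HM| |].
    - intros x Hx. destruct (Hu n x) as (d1 & _); [lra|].
      apply (continuity_pt_minus (Q n) (fun y => Si (u n y))); [apply HQc; lra|].
      apply (continuity_pt_comp (u n) Si).
      + apply (is_derive_continuity _ _ _ d1).
      + apply (is_derive_continuity _ _ _ (Si_derive _)).
    - intros x Hx. destruct (Hu n x) as (d1 & d2 & b1 & b2); [lra|].
      assert (Hux : 0 < u n x).
      { eapply Rlt_le_trans; [|apply Hlow; lra]. apply Rmult_lt_0_compat; lra. }
      split.
      + apply (is_derive_minus (Q n) (fun y => Si (u n y))); [apply HQ; lra|].
        apply (is_derive_comp Si (u n)); [apply Si_derive_neq; lra|exact d1].
      + replace (sin (u n x) / x - u1 n x * (sin (u n x) / u n x))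
          with (sin (u n x) * ((u n x - x * u1 n x) / (x * u n x))) by (field; lra).
        rewrite Rabs_mult, <- (Rmult_1_l M).
        apply Rmult_le_compat; try apply Rabs_pos; [apply Rabs_sin_le|].
        assert (Hxu : 0 < x * u n x) by (apply Rmult_lt_0_compat; lra).
        unfold Rdiv; rewrite Rabs_mult, (Rabs_right (/ (x * u n x)))
          by (apply Rle_ge; left; apply Rinv_0_lt_compat; exact Hxu).
        apply Rle_div_l; [exact Hxu|]. apply Rabs_le.
        pose proof (Hdiff 1 x (or_introl eq_refl) ltac:(lra)).
        pose proof (Hdiff (-1) x (or_intror eq_refl) ltac:(lra)). lra. }
  assert (H2 : Rabs (Q n delta - Q n ep) <= K / c n).
  { apply (oscillatory_bound (Q n) (u n) (u1 n) (u2 n) (fun y => / y) (fun y => - / (y * y)));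
      try lra.
    - intros x Hx. destruct (Hu n x) as (d1 & d2 & b1 & b2); [lra|].
      split; [apply HQ; lra|]. split; [exact d1|split; [exact d2|]].
      auto_derive; [lra|field; lra].
    - intros x Hx. destruct (Hu n x) as (d1 & d2 & b1 & b2); [lra|].
      split; [exact b1|split; [exact b2|split]].
      + rewrite Rabs_right; [apply Rinv_le_contravar; lra|].
        apply Rle_ge; left; apply Rinv_0_lt_compat; lra.
      + rewrite Rabs_Ropp, Rabs_right; [apply Rinv_le_contravar; nra|].
        apply Rle_ge; left; apply Rinv_0_lt_compat; nra. }
  assert (H3 : K / c n < eps / 4).
  { apply Rlt_div_l; [lra|].
    apply Rlt_le_trans with (eps / 4 * (X / ep + 4 * K / eps)).
    - replace (eps / 4 * (X / ep + 4 * K / eps)) with (K + eps / 4 * (X / ep)) by (field; lra).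
      assert (0 < eps / 4 * (X / ep)) by (apply Rmult_lt_0_compat; lra). lra.
    - apply Rmult_le_compat_l; lra. }
  assert (H4 : Rabs (Si (u n ep) - PI / 2) < eps / 4).
  { apply HSi. eapply Rle_trans; [|apply Hlow; lra].
    apply Rle_trans with (X / ep * ep); [right; field; lra|].
    apply Rmult_le_compat_r; lra. }
  rewrite HQ0, Hu0, Si_0 in H1.
  apply Rabs_le_between in H1, H2. apply Rabs_lt_between in H4. apply Rabs_lt_between. lra.
Qed.

(** * The phase of the Blaschke product *)

(** Squared distance from [z] to the real point [t], kept free of square roots. *)
Definition dist2 (z : Cx) (t : R) : R := (t - Re z) ^ 2 + Im z ^ 2.

Lemma dist2_pos z t : 0 < Im z -> 0 < dist2 z t.
Proof.
  intros H; unfold dist2. pose proof (pow2_ge_0 (t - Re z)). pose proof (pow_lt _ 2 H). lra.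
Qed.

(* [exp (i theta)] is, up to a constant factor, the Blaschke product of the [a k]. *)
Definition theta (a : nat -> Cx) (n : nat) (t : R) : R :=
  Rsum (fun k => 2 * atan ((t - Re (a k)) / Im (a k))) n.
Definition theta1 (a : nat -> Cx) (n : nat) (t : R) : R :=
  Rsum (fun k => 2 * Im (a k) / dist2 (a k) t) n.
Definition theta2 (a : nat -> Cx) (n : nat) (t : R) : R :=
  Rsum (fun k => - (4 * Im (a k) * (t - Re (a k))) / dist2 (a k) t ^ 2) n.

Lemma theta_derive a n t : (forall k, 0 < Im (a k)) -> is_derive (theta a n) t (theta1 a n t).
Proof.
  intros Ha. apply (Rsum_derive (fun k t => 2 * atan ((t - Re (a k)) / Im (a k)))).
  intros k; specialize (Ha k). pose proof (dist2_pos _ t Ha). unfold dist2 in *.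
  auto_derive; [exact Logic.I|].
  field. split; [lra|]. nra.
Qed.

Lemma theta1_derive a n t : (forall k, 0 < Im (a k)) -> is_derive (theta1 a n) t (theta2 a n t).
Proof.
  intros Ha. apply (Rsum_derive (fun k t => 2 * Im (a k) / dist2 (a k) t)).
  intros k; specialize (Ha k). pose proof (dist2_pos _ t Ha). unfold dist2 in *.
  auto_derive; [lra|]. field. lra.
Qed.

Lemma Cnorm_lt (z : Cx) eps : 0 < eps -> Re z ^ 2 + Im z ^ 2 < eps ^ 2 -> Cnorm z < eps.
Proof.
  intros He H. unfold Cnorm. rewrite <- (sqrt_pow2 eps) by lra.
  apply sqrt_lt_1_alt. split; [nra|]. simpl in *; lra.
Qed.

Lemma no_real_accumulation (a : nat -> Cx) (x : R) :
  no_real_limit_points a ->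
  ~ (forall N eps, 0 < eps -> exists k, (N <= k)%nat /\ dist2 (a k) x < eps ^ 2).
Proof.
  intros Hn H.
  assert (Hp : forall j, 0 < / (INR j + 1)).
  { intros j; apply Rinv_0_lt_compat; pose proof (pos_INR j); lra. }
  destruct (functional_choice _ _ (fun (p : nat * nat) k => (fst p <= k)%nat /\
              dist2 (a k) x < (/ (INR (snd p) + 1)) ^ 2)) as [g Hg].
  { intros [N j]; apply H, Hp. }
  (* Each index is chosen above its predecessor and with the next accuracy, as a strictly increasing
     subsequence is required. *)
  set (phi := fix phi n := match n with O => g (0, 0)%nat | S m => g (S (phi m), S m) end).
  assert (Hphi : forall n, dist2 (a (phi n)) x < (/ (INR n + 1)) ^ 2).
  { intros [|n]; apply (Hg (_, _)). }
  apply (Hn phi x).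
  - intros n. apply (Hg (S (phi n), S n)).
  - intros eps Heps. destruct (nfloor_ex (/ eps)) as [N [_ HN]].
    { left; apply Rinv_0_lt_compat; exact Heps. }
    exists N; intros n HnN. apply Cnorm_lt; [exact Heps|].
    apply Rlt_le_trans with ((/ (INR n + 1)) ^ 2).
    + specialize (Hphi n). unfold dist2 in Hphi.
      unfold Csub, Cadd, Copp, RtoC, Re, Im in *; simpl in *. nra.
    + apply le_INR in HnN. apply pow_incr. split; [left; apply Hp|].
      rewrite <- (Rinv_inv eps). apply Rinv_le_contravar.
      * apply Rinv_0_lt_compat; exact Heps.
      * lra.
Qed.

(** Compactness: otherwise some [a k] come within [1 / (j + 1)] of points [t j] of [[A, B]], and a
    cluster point [l] of the [t j] would be approached by [a k] with arbitrarily large [k]. *)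
Lemma no_real_limit_points_dist (a : nat -> Cx) (A B : R) :
  (forall k, 0 < Im (a k)) -> no_real_limit_points a ->
  exists r, 0 < r /\ forall k t, A <= t <= B -> r ^ 2 <= dist2 (a k) t.
Proof.
  intros Ha Hn. apply NNPP; intros Hno.
  assert (Hp : forall j, 0 < / (INR j + 1)).
  { intros j; apply Rinv_0_lt_compat; pose proof (pos_INR j); lra. }
  assert (Hex : forall j : nat, exists t, A <= t <= B /\
            exists k, dist2 (a k) t < (/ (INR j + 1)) ^ 2).
  { intros j; apply NNPP; intros Hj. apply Hno. exists (/ (INR j + 1)); split; [apply Hp|].
    intros k t Ht. apply Rnot_lt_le; intros Hlt. apply Hj; exists t; split; [exact Ht|].
    exists k; exact Hlt. }
  apply functional_choice in Hex. destruct Hex as [t Ht].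
  destruct (Bolzano_Weierstrass t (fun c => A <= c <= B)) as [l Hl].
  { apply compact_P3. }
  { intros j; apply Ht. }
  apply (no_real_accumulation a l Hn). intros N0 eps0 Heps0.
  apply NNPP; intros Hno'.
  (* The finitely many indices below [N0] keep a positive height over the axis, so with radius [rho]
     one lower bound at [l] holds for every index. *)
  assert (Hmin : exists m, 0 < m /\ forall k, (k < N0)%nat -> m <= Im (a k)).
  { clear Hno'. induction N0 as [|N [m [Hm Hk]]]; [exists 1; split; [lra|lia]|].
    exists (Rmin m (Im (a N))); split; [apply Rmin_glb_lt; auto|].
    intros k Hlt. destruct (Nat.eq_dec k N) as [->|Hne]; [apply Rmin_r|].
    eapply Rle_trans; [apply Rmin_l|]. apply Hk; lia. }
  destruct Hmin as [m [Hm Hk]].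
  set (rho := Rmin eps0 m).
  assert (Hrho : 0 < rho) by (apply Rmin_glb_lt; auto).
  assert (rho <= eps0) by apply Rmin_l. assert (rho <= m) by apply Rmin_r.
  assert (Hd : forall k, rho ^ 2 <= dist2 (a k) l).
  { intros k. destruct (Nat.lt_ge_cases k N0) as [Hlt|Hge].
    - specialize (Hk k Hlt). unfold dist2. assert (rho ^ 2 <= Im (a k) ^ 2) by (apply pow_incr; lra).
      pose proof (pow2_ge_0 (l - Re (a k))). lra.
    - apply Rnot_lt_le; intros Hlt. apply Hno'; exists k; split; [exact Hge|].
      eapply Rlt_le_trans; [exact Hlt|]. apply pow_incr; lra. }
  destruct (nfloor_ex (2 / rho)) as [N [_ HN]].
  { left; apply Rdiv_lt_0_compat; lra. }
  assert (Hr2 : 0 < rho / 2) by lra.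
  destruct (Hl (fun y => Rabs (y - l) < rho / 2) N) as [p [HpN Hpl]].
  { exists (mkposreal _ Hr2). intros y Hy; exact Hy. }
  destruct (Ht p) as [_ [k Hkp]]. specialize (Hd k).
  assert ((/ (INR p + 1)) ^ 2 <= (rho / 2) ^ 2).
  { apply pow_incr; split; [left; apply Hp|].
    replace (rho / 2) with (/ (2 / rho)) by (field; lra).
    apply Rinv_le_contravar; [apply Rdiv_lt_0_compat; lra|].
    apply le_INR in HpN; lra. }
  assert ((t p - l) ^ 2 < (rho / 2) ^ 2).
  { rewrite <- (pow2_abs (t p - l)). cbv beta in Hpl.
    pose proof (Rabs_pos (t p - l)). nra. }
  unfold dist2 in *.
  (* In squared form the triangle inequality is [(u - v)^2 <= 2 u^2 + 2 v^2]; two squares below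
     [(rho / 2)^2] then give a squared distance below [rho ^ 2]. *)
  pose proof (pow2_ge_0 ((t p - Re (a k)) + (t p - l))). nra.
Qed.

(** Both bounds hold term by term. The ratio of the second to the first derivative is at most
    [2 |t - Re a| / |t - a|^2 <= 2 / r], with [r] the distance of the [a k] from [[A, B]]. The
    constant [c] comes from [|t - a|^2 <= 2 (T^2 + 1) (1 + |a|^2)]. *)
Lemma theta_bounds (a : nat -> Cx) (A B : R) :
  (forall k, 0 < Im (a k)) -> no_real_limit_points a ->
  exists M c, 0 <= M /\ 0 < c /\ forall n t, A <= t <= B ->
    c * sigmaN a n <= theta1 a n t /\ Rabs (theta2 a n t) <= M * theta1 a n t.
Proof.
  intros Ha Hn. destruct (no_real_limit_points_dist a A B Ha Hn) as [r [Hr Hd]].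
  set (T := Rmax (Rabs A) (Rabs B)).
  assert (HT : forall t, A <= t <= B -> t ^ 2 <= T ^ 2).
  { intros t Ht. rewrite <- (pow2_abs t). apply pow_incr; split; [apply Rabs_pos|].
    apply RmaxAbs; lra. }
  assert (HT0 : 0 <= T ^ 2) by apply pow2_ge_0.
  exists (2 / r), (/ (T ^ 2 + 1)). split; [apply Rdiv_le_0_compat; lra|].
  split; [apply Rinv_0_lt_compat; lra|]. intros n t Ht. specialize (HT t Ht). split.
  - unfold sigmaN, theta1. rewrite <- Rsum_scal. apply Rsum_le; intros k _.
    specialize (Ha k). specialize (Hd k t Ht). pose proof (dist2_pos _ t Ha) as Hp.
    rewrite Rabs_right by lra.
    assert (E : Cnorm (a k) ^ 2 = Re (a k) ^ 2 + Im (a k) ^ 2).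
    { unfold Cnorm. rewrite pow2_sqrt; [ring|nra]. }
    rewrite E. pose proof (pow2_ge_0 (Re (a k))). pose proof (pow2_ge_0 (Im (a k))).
    replace (/ (T ^ 2 + 1) * (Im (a k) / (1 + (Re (a k) ^ 2 + Im (a k) ^ 2))))
      with (2 * Im (a k) * / (2 * ((T ^ 2 + 1) * (1 + (Re (a k) ^ 2 + Im (a k) ^ 2)))))
      by (field; lra).
    unfold Rdiv. apply Rmult_le_compat_l; [lra|]. apply Rinv_le_contravar; [exact Hp|].
    unfold dist2.
    assert ((t - Re (a k)) ^ 2 <= 2 * t ^ 2 + 2 * Re (a k) ^ 2).
    { pose proof (pow2_ge_0 (t + Re (a k))). nra. }
    assert (0 <= T ^ 2 * (Re (a k) ^ 2 + Im (a k) ^ 2)) by (apply Rmult_le_pos; lra).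
    nra.
  - unfold theta2, theta1. rewrite <- Rsum_scal.
    eapply Rle_trans; [apply Rsum_Rabs|]. apply Rsum_le; intros k _.
    specialize (Ha k). specialize (Hd k t Ht). pose proof (dist2_pos _ t Ha) as Hp.
    set (D := dist2 (a k) t) in *. set (s := t - Re (a k)).
    assert (Hs : Rabs s * r <= D).
    { assert (Rabs s ^ 2 <= D) by (rewrite pow2_abs; unfold D, dist2; fold s; nra).
      pose proof (Rabs_pos s). nra. }
    unfold Rdiv at 1. rewrite Rabs_mult, Rabs_Ropp, Rabs_mult.
    rewrite (Rabs_right (4 * Im (a k))) by lra.
    assert (HD2 : 0 < / D ^ 2) by (apply Rinv_0_lt_compat, pow_lt; exact Hp).
    rewrite (Rabs_right (/ D ^ 2)) by lra.
    replace (2 / r * (2 * Im (a k) / D)) with (4 * Im (a k) * (D / r) * / D ^ 2)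
      by (field; lra).
    apply Rmult_le_compat_r; [lra|]. apply Rmult_le_compat_l; [lra|].
    apply Rle_div_r; lra.
Qed.

Lemma sigmaN_lim (a : nat -> Cx) c :
  0 < c -> cv_infty (sigmaN a) -> is_lim_seq (fun n => c * sigmaN a n) p_infty.
Proof.
  intros Hc H. apply is_lim_seq_spec. intros M.
  destruct (H (M / c)) as [N HN]. exists N; intros n Hn. specialize (HN n Hn).
  apply Rlt_div_l in HN; [|exact Hc]. lra.
Qed.

(** * The reproducing kernel *)

Lemma Cx_eq (z w : Cx) : Re z = Re w -> Im z = Im w -> z = w.
Proof. destruct z, w; simpl; intros -> ->; reflexivity. Qed.

Lemma Cx_ring_theory : ring_theory (RtoC 0) (RtoC 1) Cadd Cmul Csub Copp (@eq Cx).
Proof. split; intros; apply Cx_eq; simpl; unfold Re, Im; simpl; ring. Qed.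
Add Ring Cx_ring : Cx_ring_theory.

Lemma Cconj_mul z w : Cconj (Cmul z w) = Cmul (Cconj z) (Cconj w).
Proof. apply Cx_eq; unfold Cconj, Cmul, Re, Im; simpl; ring. Qed.

Lemma Cconj_sub z w : Cconj (Csub z w) = Csub (Cconj z) (Cconj w).
Proof. apply Cx_eq; unfold Cconj, Csub, Cadd, Copp, Re, Im; simpl; ring. Qed.

Lemma Cconj_div z w : Cconj (Cdiv z w) = Cdiv (Cconj z) (Cconj w).
Proof.
  unfold Cdiv. rewrite Cconj_mul. f_equal.
  unfold Cconj, Cinv, Re, Im; simpl. rewrite Rmult_opp_opp. apply Cx_eq; simpl; unfold Re, Im; simpl; [reflexivity|].
  unfold Rdiv; ring.
Qed.

Lemma Cconj_RtoC r : Cconj (RtoC r) = RtoC r.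
Proof. apply Cx_eq; unfold Cconj, RtoC, Re, Im; simpl; ring. Qed.

Lemma Cconj_conj z : Cconj (Cconj z) = z.
Proof. apply Cx_eq; unfold Cconj, Re, Im; simpl; ring. Qed.

Lemma chi_conj c : chi (Cconj c) = Cconj (chi c).
Proof.
  assert (E : Cadd (RtoC 1) (Cmul (Cconj c) (Cconj c)) =
              Cconj (Cadd (RtoC 1) (Cmul c c))).
  { apply Cx_eq; unfold Cconj, Cadd, Cmul, RtoC, Re, Im; simpl; ring. }
  assert (N : forall z, Cnorm (Cconj z) = Cnorm z).
  { intros z; unfold Cnorm, Cconj, Re, Im; simpl. rewrite Rmult_opp_opp; reflexivity. }
  unfold chi. rewrite E, N. destruct Req_dec_T.
  - rewrite Cconj_RtoC; reflexivity.
  - rewrite Cconj_div, Cconj_RtoC; reflexivity.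
Qed.

Lemma chi_unimodular c : Cmul (chi c) (Cconj (chi c)) = RtoC 1.
Proof.
  unfold chi. set (w := Cadd (RtoC 1) (Cmul c c)). destruct Req_dec_T as [|Hne].
  - rewrite Cconj_RtoC; ring.
  - assert (Hs : Cnorm w * Cnorm w = Re w * Re w + Im w * Im w).
    { unfold Cnorm. apply sqrt_sqrt. nra. }
    assert (Hn : Re w * Re w + Im w * Im w <> 0).
    { rewrite <- Hs. apply Rmult_integral_contrapositive; auto. }
    rewrite Cconj_div, Cconj_RtoC.
    set (n := Cnorm w) in *. clearbody n w. destruct w as [x y].
    unfold Cdiv, Cmul, Cinv, Cconj, RtoC, Re, Im in *; simpl in *.
    assert (Hn' : x * x + - y * - y <> 0) by lra.
    apply Cx_eq; unfold Re, Im; simpl; field_simplify_eq; try (split; assumption); try assumption.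
    replace (n ^ 2) with (n * n) by ring. rewrite Hs. ring.
Qed.

Lemma cos_2atan s : cos (2 * atan s) = (1 - s ^ 2) / (1 + s ^ 2).
Proof.
  rewrite cos_2a_cos, cos_atan.
  assert (H : 0 < 1 + s ^ 2) by nra.
  replace (1 + s²) with (1 + s ^ 2) by (unfold Rsqr; ring).
  assert (Hs : sqrt (1 + s ^ 2) * sqrt (1 + s ^ 2) = 1 + s ^ 2) by (apply sqrt_sqrt; lra).
  assert (0 < sqrt (1 + s ^ 2)) by (apply sqrt_lt_R0; exact H).
  replace (2 * (1 / sqrt (1 + s ^ 2)) * (1 / sqrt (1 + s ^ 2)) - 1)
    with (2 / (sqrt (1 + s ^ 2) * sqrt (1 + s ^ 2)) - 1) by (field; lra).
  rewrite Hs; field; lra.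
Qed.

Lemma sin_2atan s : sin (2 * atan s) = 2 * s / (1 + s ^ 2).
Proof.
  rewrite sin_2a, cos_atan, sin_atan.
  assert (H : 0 < 1 + s ^ 2) by nra.
  replace (1 + s²) with (1 + s ^ 2) by (unfold Rsqr; ring).
  assert (Hs : sqrt (1 + s ^ 2) * sqrt (1 + s ^ 2) = 1 + s ^ 2) by (apply sqrt_sqrt; lra).
  assert (0 < sqrt (1 + s ^ 2)) by (apply sqrt_lt_R0; exact H).
  replace (2 * (s / sqrt (1 + s ^ 2)) * (1 / sqrt (1 + s ^ 2)))
    with (2 * s / (sqrt (1 + s ^ 2) * sqrt (1 + s ^ 2))) by (field; lra).
  rewrite Hs; reflexivity.
Qed.

Lemma cos_sin_phase (c : Cx) t :
  0 < Im c ->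
  cos (2 * atan ((t - Re c) / Im c)) = (Im c ^ 2 - (t - Re c) ^ 2) / dist2 c t /\
  sin (2 * atan ((t - Re c) / Im c)) = 2 * Im c * (t - Re c) / dist2 c t.
Proof.
  intros Hc. pose proof (dist2_pos c t Hc) as Hp. unfold dist2 in *.
  rewrite cos_2atan, sin_2atan. split; field; split; nra.
Qed.

(** For real [s] the quotient [(s - c) / (s - conj c)] is minus the unit complex number of angle
    [2 atan ((s - Re c) / Im c)]. The sign and the unimodular [chi c] cancel against the
    conjugate. *)
Lemma bfactor_mul_conj (c : Cx) t x :
  0 < Im c ->
  Cmul (bfactor c (RtoC t)) (Cconj (bfactor c (RtoC x))) =
  (cos (2 * atan ((t - Re c) / Im c) - 2 * atan ((x - Re c) / Im c)),
   sin (2 * atan ((t - Re c) / Im c) - 2 * atan ((x - Re c) / Im c))).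
Proof.
  intros Hc. rewrite cos_minus, sin_minus.
  destruct (cos_sin_phase c t Hc) as [-> ->]. destruct (cos_sin_phase c x Hc) as [-> ->].
  pose proof (dist2_pos c t Hc) as Ht. pose proof (dist2_pos c x Hc) as Hx.
  assert (Hm : forall s, Cdiv (Csub (RtoC s) c) (Csub (RtoC s) (Cconj c)) =
     (- ((Im c ^ 2 - (s - Re c) ^ 2) / dist2 c s), - (2 * Im c * (s - Re c) / dist2 c s))).
  { intros s. pose proof (dist2_pos c s Hc). unfold dist2 in *. destruct c as [p q].
    apply Cx_eq; unfold Cdiv, Cinv, Csub, Cadd, Copp, Cmul, Cconj, RtoC, Re, Im in *; simpl in *;
      field; repeat split; nra. }
  unfold bfactor. rewrite !Hm, Cconj_mul.
  transitivity (Cmul (Cmul (chi c) (Cconj (chi c)))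
    (Cmul (- ((Im c ^ 2 - (t - Re c) ^ 2) / dist2 c t), - (2 * Im c * (t - Re c) / dist2 c t))
     (Cconj (- ((Im c ^ 2 - (x - Re c) ^ 2) / dist2 c x), - (2 * Im c * (x - Re c) / dist2 c x))))).
  { ring. }
  rewrite chi_unimodular.
  apply Cx_eq; unfold Cmul, Cconj, RtoC, Re, Im; simpl; ring.
Qed.

Lemma Bplus_mul_conj a n t x :
  (forall k, 0 < Im (a k)) ->
  Cmul (Bplus a n (RtoC t)) (Cconj (Bplus a n (RtoC x))) =
  (cos (theta a n t - theta a n x), sin (theta a n t - theta a n x)).
Proof.
  intros Ha. unfold Bplus, theta. induction n as [|n IH]; cbn [Cprod Rsum].
  - rewrite Rminus_diag, cos_0, sin_0. apply Cx_eq; unfold Cmul, Cconj, RtoC, Re, Im; simpl; ring.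
  - rewrite Cconj_mul.
    match goal with |- Cmul (Cmul ?p ?b) (Cmul ?q ?d) = _ =>
      transitivity (Cmul (Cmul p q) (Cmul b d)); [ring|] end.
    rewrite IH, (bfactor_mul_conj (a n) t x (Ha n)).
    match goal with |- _ = (cos ?e, _) =>
      match goal with |- Cmul (cos ?p, _) (cos ?q, _) = _ =>
        replace e with (p + q) by ring end end.
    rewrite cos_plus, sin_plus. apply Cx_eq; unfold Cmul, Re, Im; simpl; ring.
Qed.

(** Conjugation on the real axis exchanges [a k] with [bseq a (S k)] factor by factor, [chi]
    included. The successor reflects the index shift in [bseq], so [Phi] at [-n-1] pairs with [Phi]
    at [n]. *)
Lemma Phiminus_conj a n r :
  Phiminus a (S n) (RtoC r) = Cconj (Phiplus a n (RtoC r)).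
Proof.
  assert (Hb : forall k, bseq a (S k) = Cconj (a k)).
  { intros k; unfold bseq. rewrite Nat.sub_succ, Nat.sub_0_r. reflexivity. }
  unfold Phiminus, Phiplus, Bminus, Bplus.
  rewrite Cconj_mul, Cconj_div, Cconj_sub, !Cconj_RtoC, !Hb.
  f_equal.
  - f_equal. f_equal. f_equal. unfold Cconj, Im; simpl. ring.
  - rewrite Nat.sub_succ, Nat.sub_0_r. induction n as [|n IH]; cbn [Cprod].
    + rewrite Cconj_RtoC; reflexivity.
    + rewrite Cconj_mul, IH, Hb. f_equal.
      unfold bfactor. rewrite Cconj_mul, Cconj_div, !Cconj_sub, !Cconj_RtoC, chi_conj.
      reflexivity.
Qed.

Lemma Csum_ext (f g : nat -> Cx) n :
  (forall k, (k < n)%nat -> f k = g k) -> Csum f n = Csum g n.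
Proof.
  induction n as [|n IH]; intros H; simpl; [reflexivity|].
  rewrite IH, H; auto with arith.
Qed.

Lemma Csum_succ_l (f : nat -> Cx) n :
  Csum f (S n) = Cadd (f O) (Csum (fun k => f (S k)) n).
Proof.
  induction n as [|n IH]; [simpl; ring|].
  change (Csum f (S (S n))) with (Cadd (Csum f (S n)) (f (S n))).
  rewrite IH. simpl; ring.
Qed.

Lemma Csum_mul_l z (f : nat -> Cx) n : Csum (fun k => Cmul z (f k)) n = Cmul z (Csum f n).
Proof. induction n as [|n IH]; simpl; [ring|rewrite IH; ring]. Qed.

(** The two indices that enter are exactly a conjugate pair, which suits the induction on [n] in the
    kernel formula. *)
Lemma Csum_symmetric_succ (g : Z -> Cx) n :
  Csum (fun j => g (Z.of_nat j - Z.of_nat (S n))%Z) (2 * S n) =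
  Cadd (Csum (fun j => g (Z.of_nat j - Z.of_nat n)%Z) (2 * n))
       (Cadd (g (Z.of_nat n)) (g (- Z.of_nat (S n))%Z)).
Proof.
  replace (2 * S n)%nat with (S (S (2 * n))) by lia.
  rewrite Csum_succ_l. cbn [Csum].
  replace (Z.of_nat 0 - Z.of_nat (S n))%Z with (- Z.of_nat (S n))%Z by lia.
  replace (Z.of_nat (S (2 * n)) - Z.of_nat (S n))%Z with (Z.of_nat n) by lia.
  rewrite (Csum_ext _ (fun j => g (Z.of_nat j - Z.of_nat n)%Z)); [ring|].
  intros k _; f_equal; lia.
Qed.

(** One step of a Christoffel-Darboux identity: the factor of [a n] advances the angle from [psi] to
    [psi + phi], and the increment of the sine is what the pair [n], [-n-1] contributes. *)
Lemma kernel_step a n t x :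
  (forall k, 0 < Im (a k)) ->
  (t - x) * (2 * Re (Cmul (Cconj (Phiplus a n (RtoC t))) (Phiplus a n (RtoC x)))) =
  sin (theta a (S n) t - theta a (S n) x) - sin (theta a n t - theta a n x).
Proof.
  intros Ha.
  set (psi := theta a n t - theta a n x).
  set (phi := 2 * atan ((t - Re (a n)) / Im (a n)) - 2 * atan ((x - Re (a n)) / Im (a n))).
  assert (Hpsi : theta a (S n) t - theta a (S n) x = psi + phi).
  { unfold psi, phi, theta; cbn [Rsum]; ring. }
  rewrite Hpsi, sin_plus. unfold phi. rewrite cos_minus, sin_minus.
  pose proof (Ha n) as Hn.
  destruct (cos_sin_phase (a n) t Hn) as [-> ->].
  destruct (cos_sin_phase (a n) x Hn) as [-> ->].
  unfold Phiplus. rewrite Cconj_mul, Cconj_div, Cconj_sub, !Cconj_RtoC, Cconj_conj.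
  match goal with |- context [Cmul (Cmul ?p (Cconj ?b)) (Cmul ?q ?d)] =>
    replace (Cmul (Cmul p (Cconj b)) (Cmul q d))
      with (Cmul (Cmul p q) (Cconj (Cmul b (Cconj d)))) by
      (rewrite Cconj_mul, Cconj_conj; ring) end.
  rewrite (Bplus_mul_conj a n t x Ha). fold psi.
  set (C := cos psi). set (S0 := sin psi).
  assert (Hs : sqrt (Im (a n)) * sqrt (Im (a n)) = Im (a n)) by (apply sqrt_sqrt; lra).
  pose proof (dist2_pos (a n) t Hn) as Ht. pose proof (dist2_pos (a n) x Hn) as Hx.
  unfold dist2 in *.
  (* With [cos psi] and [sin psi] as free values and [Im (a n)] written [q * q], the claim is an
     identity of rational functions. *)
  set (q := sqrt (Im (a n))) in *. clearbody q C S0. destruct (a n) as [al be].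
  unfold Cdiv, Cinv, Csub, Cadd, Copp, Cmul, Cconj, RtoC, Re, Im in *; simpl in *.
  rewrite <- Hs in *.
  field_simplify_eq; [ring|repeat split; nra].
Qed.

Lemma kernel_sum a n t x :
  (forall k, 0 < Im (a k)) -> t <> x ->
  Csum (fun j => let k := (Z.of_nat j - Z.of_nat n)%Z in
          Cmul (Cconj (Phi a k (RtoC t))) (Phi a k (RtoC x))) (2 * n) =
  RtoC (sin (theta a n t - theta a n x) / (t - x)).
Proof.
  intros Ha Htx. cbv zeta.
  set (g := fun k => Cmul (Cconj (Phi a k (RtoC t))) (Phi a k (RtoC x))).
  change (Csum (fun j => g (Z.of_nat j - Z.of_nat n)%Z) (2 * n) =
    RtoC (sin (theta a n t - theta a n x) / (t - x))).
  induction n as [|n IH].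
  - simpl. rewrite Rminus_diag, sin_0. unfold Rdiv; rewrite Rmult_0_l; reflexivity.
  - rewrite Csum_symmetric_succ, IH.
    assert (H1 : g (Z.of_nat n) = Cmul (Cconj (Phiplus a n (RtoC t))) (Phiplus a n (RtoC x))).
    { unfold g, Phi. replace (0 <=? Z.of_nat n)%Z with true by (symmetry; apply Z.leb_le; lia).
      rewrite Nat2Z.id; reflexivity. }
    assert (H2 : g (- Z.of_nat (S n))%Z = Cconj (g (Z.of_nat n))).
    { rewrite H1. unfold g, Phi.
      replace (0 <=? - Z.of_nat (S n))%Z with false by (symmetry; apply Z.leb_gt; lia).
      rewrite Z.opp_involutive, Nat2Z.id, !Phiminus_conj, Cconj_mul. reflexivity. }
    rewrite H2, H1.
    pose proof (kernel_step a n t x Ha) as Hk.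
    set (w := Cmul _ (Phiplus a n (RtoC x))) in *. clearbody w.
    apply Cx_eq; unfold Cadd, RtoC, Cconj, Re, Im in *; cbn [fst snd]; [|ring].
    apply Rmult_eq_reg_l with (t - x); [|lra].
    transitivity (sin (theta a n t - theta a n x) + (t - x) * (2 * fst w)); [field; lra|].
    rewrite Hk. field; lra.
Qed.

(** * Complex-valued integrals *)

Definition gCint (f : R -> Cx) (I : Cx) : Prop :=
  gint (fun t => Re (f t)) (Re I) /\ gint (fun t => Im (f t)) (Im I).

Lemma is_CLInt_gCint f I : is_CLInt f I -> gCint f I.
Proof. intros [H1 H2]; split; apply is_LInt_gint; assumption. Qed.

Lemma gCint_mul_r f I z : gCint f I -> gCint (fun t => Cmul (f t) z) (Cmul I z).
Proof.
  intros [H1 H2]; split; unfold Cmul; cbn [Re Im fst snd].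
  - replace (Re I * Re z - Im I * Im z) with (Re z * Re I + (- Im z) * Im I) by ring.
    apply gint_ext with (e' := fun _ => 0)
      (f := fun t => Re z * Re (f t) + (- Im z) * Im (f t)); [intros; simpl; ring|].
    apply gint_plus; apply gint_scal; assumption.
  - replace (Re I * Im z + Im I * Re z) with (Im z * Re I + Re z * Im I) by ring.
    apply gint_ext with (e' := fun _ => 0)
      (f := fun t => Im z * Re (f t) + Re z * Im (f t)); [intros; simpl; ring|].
    apply gint_plus; apply gint_scal; assumption.
Qed.

Lemma gCint_Csum (f : nat -> R -> Cx) (I : nat -> Cx) n :
  (forall k, gCint (f k) (I k)) -> gCint (fun t => Csum (fun k => f k t) n) (Csum I n).
Proof.
  intros H; induction n as [|n IH]; [split; apply gint_0|].
  destruct IH as [H1 H2], (H n) as [H3 H4].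
  split; simpl; apply gint_plus; assumption.
Qed.

(** * Convergence *)

(** [oscillatory_bound] applies with [m = c * sigmaN a n]. Its numerator does not depend on [n],
    since the constants of [theta_bounds] depend only on the interval. *)
Lemma phase_lim_0 (a : nat -> Cx) (x0 A B R0 R1 : R) (rho rho1 : R -> R) (Q : nat -> R -> R) :
  (forall k, 0 < Im (a k)) -> no_real_limit_points a -> cv_infty (sigmaN a) ->
  A <= B ->
  (forall n x, A <= x <= B ->
     is_derive (Q n) x (sin (theta a n x - theta a n x0) * rho x)) ->
  (forall x, A <= x <= B -> is_derive rho x (rho1 x) /\ Rabs (rho x) <= R0 /\ Rabs (rho1 x) <= R1) ->
  is_lim_seq (fun n => Q n B - Q n A) 0.
Proof.
  intros Ha Hn Hs HAB HQ Hrho.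
  destruct (theta_bounds a A B Ha Hn) as (M & c & HM & Hc & Hb).
  pose proof (sigmaN_lim a c Hc Hs) as Hl. apply is_lim_seq_spec in Hl.
  destruct (Hrho A) as (_ & HR0 & HR1); [lra|].
  pose proof (Rabs_pos (rho A)). pose proof (Rabs_pos (rho1 A)).
  set (K := 2 * R0 + (B - A) * (R1 + R0 * M)).
  assert (HK : 0 <= K).
  { unfold K. apply Rplus_le_le_0_compat; [lra|]. apply Rmult_le_pos; [lra|].
    apply Rplus_le_le_0_compat; [lra|]. apply Rmult_le_pos; lra. }
  apply is_lim_seq_eps; intros eps Heps.
  destruct (Hl (K / eps)) as [N HN]. exists N; intros n Hn'. specialize (HN n Hn').
  assert (0 <= K / eps) by (apply Rdiv_le_0_compat; lra).
  rewrite Rminus_0_r. apply Rle_lt_trans with (K / (c * sigmaN a n)).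
  - apply (oscillatory_bound (Q n) (fun x => theta a n x - theta a n x0) (theta1 a n)
             (theta2 a n) rho rho1); try lra.
    + intros x Hx. split; [apply HQ; exact Hx|]. split; [|split].
      * replace (theta1 a n x) with (theta1 a n x - 0) by ring.
        apply (is_derive_minus (theta a n) (fun _ => theta a n x0));
          [apply theta_derive; exact Ha|apply is_derive_cst].
      * apply theta1_derive; exact Ha.
      * apply Hrho; exact Hx.
    + intros x Hx. destruct (Hb n x Hx) as [b1 b2]. destruct (Hrho x Hx) as (_ & b3 & b4). auto.
  - apply Rlt_div_l; [lra|]. apply Rmult_lt_compat_r with (r := eps) in HN; [|exact Heps].
    replace (K / eps * eps) with K in HN by (field; lra). lra.
Qed.

Lemma is_derive_comp_shift (F : R -> R) x0 y l :
  is_derive F (x0 + y) l -> is_derive (fun y => F (x0 + y)) y l.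
Proof.
  intros H. replace l with (1 * l) by ring.
  apply (is_derive_comp F (fun y => x0 + y)); [exact H|auto_derive; [exact Logic.I|ring]].
Qed.

Lemma is_derive_comp_reflect (F : R -> R) x0 y l :
  is_derive F (x0 - y) l -> is_derive (fun y => - F (x0 - y)) y l.
Proof.
  intros H. replace l with (- (-1 * l)) by ring.
  apply (is_derive_opp (fun y => F (x0 - y))).
  apply (is_derive_comp F (fun y => x0 - y)); [exact H|auto_derive; [exact Logic.I|ring]].
Qed.

Lemma continuity_bounded (F : R -> R) a b :
  a <= b -> (forall x, continuity_pt F x) ->
  exists M, 0 < M /\ forall x, a <= x <= b -> Rabs (F x) <= M.
Proof.
  intros Hab HF.
  destruct (continuity_ab_maj (fun x => Rabs (F x)) a b Hab) as [z [Hz _]].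
  - intros x _. apply (continuity_pt_comp F Rabs); [apply HF|apply Rcontinuity_abs].
  - exists (Rabs (F z) + 1). pose proof (Rabs_pos (F z)). split; [lra|].
    intros x Hx; specialize (Hz x Hx); lra.
Qed.

(* Splits [g(t) / (t - x0)] into the Dini quotients [hp], [hm] near [x0], the constants
   [lp], [lm] against the kernel, and the part of [g] away from [x0]. *)
Lemma dini_limit (a : nat -> Cx) (x0 delta lp lm I Kp Km : R) (g hp hm : R -> R) (J : nat -> R) :
  (forall k, 0 < Im (a k)) -> no_real_limit_points a -> cv_infty (sigmaN a) ->
  0 < delta ->
  is_LInt g I -> is_LInt hp Kp -> is_LInt hm Km ->
  (forall y, 0 < y < delta -> hp y = (g (x0 + y) - lp) / y /\ hm y = (g (x0 - y) - lm) / y) ->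
  (forall y, y < 0 \/ delta < y -> hp y = 0 /\ hm y = 0) ->
  (forall n, gint (fun t => g t * (sin (theta a n t - theta a n x0) / (t - x0))) (J n)) ->
  is_lim_seq J ((lp + lm) * (PI / 2)).
Proof.
  intros Ha Hn Hs Hdel Hg Hhp Hhm Hin Hout HJ.
  set (s := fun n t => sin (theta a n t - theta a n x0)).
  assert (Hs0 : forall n, s n x0 = 0) by (intros n; unfold s; rewrite Rminus_diag; apply sin_0).
  assert (Hsd : forall n t, is_derive (s n) t
            (theta1 a n t * cos (theta a n t - theta a n x0))).
  { intros n t. unfold s.
    apply (is_derive_comp sin (fun t => theta a n t - theta a n x0)).
    - apply is_derive_Reals, derivable_pt_lim_sin.
    - replace (theta1 a n t) with (theta1 a n t - 0) by ring.
      apply (is_derive_minus (theta a n) (fun _ => theta a n x0));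
        [apply theta_derive; exact Ha|apply is_derive_cst]. }
  assert (Hsc : forall n t, continuity_pt (s n) t)
    by (intros n t; apply (is_derive_continuity _ _ _ (Hsd n t))).
  (* The kernel with its removable singularity filled in: being continuous, it has a primitive [P n]
     on the whole line. *)
  set (D := fun n => slope (s n) x0 (theta1 a n x0)).
  assert (HDc : forall n t, continuity_pt (D n) t).
  { intros n; apply slope_continuity; [apply Hsc|].
    pose proof (Hsd n x0) as H. rewrite Rminus_diag, cos_0, Rmult_1_r in H. exact H. }
  assert (HD : forall n t, t <> x0 -> D n t = s n t / (t - x0)).
  { intros n t Ht; unfold D; rewrite slope_neq, Hs0 by exact Ht. rewrite Rminus_0_r; reflexivity. }
  set (P := fun n t => RInt (D n) x0 t). set (S1 := fun n t => RInt (s n) x0 t).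
  assert (HP : forall n t, is_derive (P n) t (D n t))
    by (intros n t; apply RInt_primitive, HDc).
  assert (HS : forall n t, is_derive (S1 n) t (s n t))
    by (intros n t; apply RInt_primitive, Hsc).
  assert (HPc : forall n t, continuity_pt (P n) t)
    by (intros n t; apply (is_derive_continuity _ _ _ (HP n t))).
  assert (HP0 : forall n, P n x0 = 0)
    by (intros n; apply (RInt_point (V := R_CompleteNormedModule))).
  assert (Hfar : forall A B, A <= B -> (x0 + delta <= A \/ B <= x0 - delta) ->
            is_lim_seq (fun n => P n B - P n A) 0).
  { intros A B HAB Hfar.
    assert (Hd2 : 0 < delta ^ 2) by (apply pow_lt; exact Hdel).
    apply (phase_lim_0 a x0 A B (/ delta) (/ delta ^ 2) (fun t => / (t - x0))
             (fun t => - / (t - x0) ^ 2)); auto.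
    - intros n x Hx. pose proof (HP n x) as H. rewrite HD in H by lra. exact H.
    - intros x Hx. split; [auto_derive; [lra|field; lra]|].
      assert (Hx' : delta <= Rabs (x - x0)).
      { destruct Hfar; [rewrite Rabs_right|rewrite Rabs_left]; lra. }
      assert (0 < Rabs (x - x0)) by lra.
      split.
      + rewrite Rabs_inv. apply Rinv_le_contravar; lra.
      + rewrite Rabs_Ropp, Rabs_inv, <- RPow_abs. apply Rinv_le_contravar; [exact Hd2|].
        apply pow_incr; lra. }
  (* The kernel away from [x0]. It is bounded by [1 / delta] uniformly in [n], as the
     Riemann-Lebesgue lemma requires, and its primitive is constant on the excluded interval. *)
  set (w := fun n t => D n t - brick (x0 - delta) (x0 + delta) t * D n t).
  destruct (is_LInt_mult_lim_0 g I (interleave (fun _ => x0 - delta) (fun _ => x0 + delta)) w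
     (fun n t => P n t - P n (clamp (x0 - delta) (x0 + delta) t)) (/ delta))
    as (J1 & HJ1 & Hl1); [exact Hg|apply Rinv_0_lt_compat; exact Hdel| | | | |].
  { intros n x. apply (continuity_pt_minus (P n) (fun t => P n (clamp (x0 - delta) (x0 + delta) t))).
    - apply HPc.
    - apply (continuity_pt_comp (clamp (x0 - delta) (x0 + delta)) (P n));
        [apply clamp_continuity|apply HPc]. }
  { intros n x Hx. apply avoids_interleave in Hx. destruct Hx as [Hx1 Hx2].
    apply (is_derive_minus (P n) (fun t => P n (clamp (x0 - delta) (x0 + delta) t)));
      [apply HP|]. apply clamp_derive; [lra|apply (Hx1 O)|apply (Hx2 O)|apply HP]. }
  { intros n x. unfold w, brick.
    assert (Hid : 0 < / delta) by (apply Rinv_0_lt_compat; exact Hdel).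
    assert (Hb : delta <= Rabs (x - x0) -> Rabs (D n x) <= / delta).
    { intros H. assert (Hx : x <> x0) by (intros ->; rewrite Rminus_diag, Rabs_R0 in H; lra).
      rewrite HD by exact Hx. unfold Rdiv; rewrite Rabs_mult, Rabs_inv, <- (Rmult_1_l (/ delta)).
      apply Rmult_le_compat; [apply Rabs_pos| |apply Rabs_sin_le|].
      - left; apply Rinv_0_lt_compat; lra.
      - apply Rinv_le_contravar; lra. }
    destruct (Rle_dec (x0 - delta) x); [destruct (Rlt_dec x (x0 + delta))|].
    - replace (D n x - 1 * D n x) with 0 by ring. rewrite Rabs_R0; lra.
    - rewrite Rmult_0_l, Rminus_0_r. apply Hb. rewrite Rabs_right; lra.
    - rewrite Rmult_0_l, Rminus_0_r. apply Hb. rewrite Rabs_left; lra. }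
  { assert (H : forall t, is_lim_seq (fun n => P n t - P n (clamp (x0 - delta) (x0 + delta) t)) 0).
    { intros t. destruct (Rle_dec t (x0 - delta)); [|destruct (Rle_dec (x0 + delta) t)].
      - rewrite clamp_left by lra.
        apply is_lim_seq_ext with (fun n => (-1) * (P n (x0 - delta) - P n t)); [intros; ring|].
        replace (Finite 0) with (Rbar_mult (-1) 0) by (simpl; f_equal; ring).
        apply is_lim_seq_scal_l, Hfar; lra.
      - rewrite clamp_right by lra. apply Hfar; lra.
      - rewrite clamp_mid by lra. apply is_lim_seq_ext with (fun _ => 0); [intros; ring|].
        apply is_lim_seq_const. }
    intros t1 t2 _. replace 0 with (0 - 0) by ring. apply is_lim_seq_minus'; apply H. }
  assert (Hosc : forall A B, A <= B -> is_lim_seq (fun n => S1 n B - S1 n A) 0).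
  { intros A B HAB. apply (phase_lim_0 a x0 A B 1 0 (fun _ => 1) (fun _ => 0)); auto.
    - intros n x _. rewrite Rmult_1_r. apply HS.
    - intros x _. rewrite Rabs_R1, Rabs_R0. split; [apply is_derive_cst|lra]. }
  (* The Dini quotient has absorbed the division by [t - x0], leaving the sine alone, with bound
     1. *)
  destruct (is_LInt_mult_lim_0 hp Kp (fun _ => 0) (fun n y => s n (x0 + y))
     (fun n y => S1 n (x0 + y)) 1) as (J2 & HJ2 & Hl2); [exact Hhp|lra| | | | |].
  { intros n x. refine (is_derive_continuity _ _ _ (is_derive_comp_shift _ _ _ _ (HS n _))). }
  { intros n x _. apply is_derive_comp_shift, HS. }
  { intros n x; apply Rabs_sin_le. }
  { intros t1 t2 H12. apply Hosc; lra. }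
  destruct (is_LInt_mult_lim_0 hm Km (fun _ => 0) (fun n y => s n (x0 - y))
     (fun n y => - S1 n (x0 - y)) 1) as (J3 & HJ3 & Hl3); [exact Hhm|lra| | | | |].
  { intros n x. refine (is_derive_continuity _ _ _ (is_derive_comp_reflect _ _ _ _ (HS n _))). }
  { intros n x _. apply is_derive_comp_reflect, HS. }
  { intros n x; apply Rabs_sin_le. }
  { intros t1 t2 H12.
    apply is_lim_seq_ext with (fun n => S1 n (x0 - t1) - S1 n (x0 - t2)); [intros; ring|].
    apply Hosc; lra. }
  destruct (theta_bounds a (x0 - delta) (x0 + delta) Ha Hn) as (M & c & HM & Hc & Hb).
  pose proof (sigmaN_lim a c Hc Hs) as Hcs.
  assert (Hl4 : is_lim_seq (fun n => P n (x0 + delta)) (PI / 2)).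
  { apply (dirichlet_phase (fun n y => P n (x0 + y))
      (fun n y => theta a n (x0 + y) - theta a n x0) (fun n y => theta1 a n (x0 + y))
      (fun n y => theta2 a n (x0 + y)) delta M (fun n => c * sigmaN a n)); auto.
    - intros n y Hy. split; [|split; [|apply Hb; lra]].
      + replace (theta1 a n (x0 + y)) with (theta1 a n (x0 + y) - 0) by ring.
        apply (is_derive_minus (fun y => theta a n (x0 + y)) (fun _ => theta a n x0));
          [|apply is_derive_cst].
        apply is_derive_comp_shift, theta_derive, Ha.
      + apply is_derive_comp_shift, theta1_derive, Ha.
    - intros n. rewrite Rplus_0_r; ring.
    - intros n y _. refine (is_derive_continuity _ _ _ (is_derive_comp_shift _ _ _ _ (HP n _))).
    - intros n y Hy. pose proof (HP n (x0 + y)) as H. rewrite HD in H by lra.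
      replace (x0 + y - x0) with y in H by ring. apply is_derive_comp_shift; exact H.
    - intros n. rewrite Rplus_0_r; apply HP0. }
  (* To the left of [x0] the phase is read backwards: [theta x0 - theta (x0 - y)] again vanishes at
     0 and increases with [y], with the sign of the second derivative changed. *)
  assert (Hl5 : is_lim_seq (fun n => - P n (x0 - delta)) (PI / 2)).
  { apply (dirichlet_phase (fun n y => - P n (x0 - y))
      (fun n y => theta a n x0 - theta a n (x0 - y)) (fun n y => theta1 a n (x0 - y))
      (fun n y => - theta2 a n (x0 - y)) delta M (fun n => c * sigmaN a n)); auto.
    - intros n y Hy. rewrite Rabs_Ropp. split; [|split; [|apply Hb; lra]].
      + replace (theta1 a n (x0 - y)) with (0 + theta1 a n (x0 - y)) by ring.
        apply (is_derive_plus (fun _ => theta a n x0) (fun y => - theta a n (x0 - y)));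
          [apply is_derive_cst|].
        apply is_derive_comp_reflect, theta_derive, Ha.
      + apply is_derive_ext with (fun y => - - theta1 a n (x0 - y));
          [intros; apply Ropp_involutive|].
        apply (is_derive_opp (fun y => - theta1 a n (x0 - y))).
        apply is_derive_comp_reflect, theta1_derive, Ha.
    - intros n. rewrite Rminus_0_r; ring.
    - intros n y _. refine (is_derive_continuity _ _ _ (is_derive_comp_reflect _ _ _ _ (HP n _))).
    - intros n y Hy. pose proof (HP n (x0 - y)) as H. rewrite HD in H by lra.
      replace (s n (x0 - y) / (x0 - y - x0)) with (sin (theta a n x0 - theta a n (x0 - y)) / y) in H.
      + apply is_derive_comp_reflect; exact H.
      + unfold s. rewrite <- (Ropp_minus_distr (theta a n (x0 - y))), sin_neg. field; lra.
    - intros n. rewrite Rminus_0_r, HP0; ring. }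
  assert (HJ4 : forall n, gint (fun t => brick x0 (x0 + delta) t * D n t) (P n (x0 + delta) - P n x0)).
  { intros n. destruct (continuity_bounded (D n) x0 (x0 + delta)) as (MD & HMD & HbD);
      [lra|apply HDc|].
    apply (gint_brick x0 (x0 + delta) (fun _ => 0) (D n) (P n) MD); auto; lra. }
  assert (HJ5 : forall n, gint (fun t => brick (x0 - delta) x0 t * D n t) (P n x0 - P n (x0 - delta))).
  { intros n. destruct (continuity_bounded (D n) (x0 - delta) x0) as (MD & HMD & HbD);
      [lra|apply HDc|].
    apply (gint_brick (x0 - delta) x0 (fun _ => 0) (D n) (P n) MD); auto; lra. }
  (* On the left [t - x0 = - y], hence the factor [-1] before [J3]; the constant [lm] multiplies
     [D n] itself, which already carries that sign. *)
  assert (HJn : forall n, J n = J1 n + J2 n + (-1) * J3 n + lp * (P n (x0 + delta) - P n x0)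
                               + lm * (P n x0 - P n (x0 - delta))).
  { intros n. apply (gint_unique _ _ _ (HJ n)).
    apply gint_ext with
      (* At [x0] and [x0 ± delta] the division, the half-open bricks and the values of [hp] and [hm]
         need not agree. *)
      (e' := interleave (fun _ => x0) (interleave (fun _ => x0 - delta) (fun _ => x0 + delta)))
      (f := fun t => g t * w n t + hp (t - x0) * s n (x0 + (t - x0)) +
         (-1) * (hm (x0 - t) * s n (x0 - (x0 - t))) +
         lp * (brick x0 (x0 + delta) t * D n t) + lm * (brick (x0 - delta) x0 t * D n t)).
    - intros t Ht. apply avoids_interleave in Ht; destruct Ht as [Ht0 Ht].
      apply avoids_interleave in Ht; destruct Ht as [Ht1 Ht2].
      specialize (Ht0 O); specialize (Ht1 O); specialize (Ht2 O); simpl in *.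
      fold (s n t). replace (x0 + (t - x0)) with t by ring. replace (x0 - (x0 - t)) with t by ring.
      unfold w. rewrite HD by exact Ht0. unfold brick.
      destruct (Rle_dec (x0 - delta) t), (Rlt_dec t (x0 + delta)), (Rle_dec x0 t), (Rlt_dec t x0);
        try lra.
      + destruct (Hin (t - x0)) as [-> _]; [lra|]. destruct (Hout (x0 - t)) as [_ ->]; [lra|].
        replace (x0 + (t - x0)) with t by ring. field; lra.
      + destruct (Hin (x0 - t)) as [_ ->]; [lra|]. destruct (Hout (t - x0)) as [-> _]; [lra|].
        replace (x0 - (x0 - t)) with t by ring. field; lra.
      + destruct (Hout (x0 - t)) as [_ ->]; [lra|]. destruct (Hout (t - x0)) as [-> _]; [lra|].
        field; lra.
      + destruct (Hout (x0 - t)) as [_ ->]; [lra|]. destruct (Hout (t - x0)) as [-> _]; [lra|].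
        field; lra.
    - repeat apply gint_plus; try apply gint_scal; auto.
      + apply (gint_translate x0 (fun y => hp y * s n (x0 + y))); apply HJ2.
      + apply (gint_reflect x0 (fun y => hm y * s n (x0 - y))); apply HJ3. }
  apply is_lim_seq_ext with (fun n => J1 n + J2 n + (-1) * J3 n + lp * P n (x0 + delta)
                               + lm * (- P n (x0 - delta))).
  { intros n; rewrite HJn, HP0; ring. }
  replace (Finite ((lp + lm) * (PI / 2))) with
    (Finite (0 + 0 + (-1) * 0 + lp * (PI / 2) + lm * (PI / 2))) by (f_equal; ring).
  repeat apply is_lim_seq_plus'; auto.
  - apply (is_lim_seq_scal_l J3 (-1) 0 Hl3).
  - apply (is_lim_seq_scal_l _ lp (PI / 2) Hl4).
  - apply (is_lim_seq_scal_l _ lm (PI / 2) Hl5).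
Qed.

Theorem theorem3
  (f : R -> Cx) (x0 : R) (Lm Lp : Cx) (delta : R) (a : nat -> Cx) (c : Z -> Cx) :
  CLIntegrable f ->
  (* Lm = f(x0-0), Lp = f(x0+0) *)
  (forall eps, 0 < eps -> exists d, 0 < d /\
     forall y, 0 < y < d -> Cnorm (Csub (f (x0 - y)) Lm) < eps) ->
  (forall eps, 0 < eps -> exists d, 0 < d /\
     forall y, 0 < y < d -> Cnorm (Csub (f (x0 + y)) Lp) < eps) ->
  0 < delta ->
  CLIntegrable (restr_0d delta (fun y => Cdiv (Csub (f (x0 - y)) Lm) (RtoC y))) ->
  CLIntegrable (restr_0d delta (fun y => Cdiv (Csub (f (x0 + y)) Lp) (RtoC y))) ->
  (forall k, 0 < Im (a k)) ->
  no_real_limit_points a ->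
  cv_infty (sigmaN a) ->
  (exists Cst, forall n, (1 <= n)%nat -> varsigmaN a n / sigmaN a n <= Cst) ->
  (* c_k = (1/pi) * int f(t) conj(Phi_k(t)) dt *)
  (forall k : Z, is_CLInt (fun t => Cmul (RtoC (1 / PI))
                     (Cmul (f t) (Cconj (Phi a k (RtoC t))))) (c k)) ->
  Ccv (fun n => Spartial a c n x0) (Cmul (RtoC (1 / 2)) (Cadd Lm Lp)).
Proof.
  intros [I [HfR HfI]] _ _ Hdel [Km [HmR HmI]] [Kp [HpR HpI]] Ha Hn Hs _ Hc.
  pose proof PI_RGT_0 as Hpi.
  (* The partial sum becomes one integral of [f] against the kernel, whose closed form holds for [t]
     other than [x0]. *)
  assert (HS : forall n, gCint (fun t => Cmul (f t)
            (RtoC (/ PI * (sin (theta a n t - theta a n x0) / (t - x0))))) (Spartial a c n x0)).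
  { intros n.
    assert (H : gCint (fun t => Csum (fun j => Cmul
        (Cmul (RtoC (1 / PI)) (Cmul (f t) (Cconj (Phi a (Z.of_nat j - Z.of_nat n) (RtoC t)))))
        (Phi a (Z.of_nat j - Z.of_nat n) (RtoC x0))) (2 * n)) (Spartial a c n x0)).
    { unfold Spartial. apply gCint_Csum. intros j; apply gCint_mul_r, is_CLInt_gCint, Hc. }
    assert (E : forall t, avoids (fun _ => x0) t -> Csum (fun j => Cmul
        (Cmul (RtoC (1 / PI)) (Cmul (f t) (Cconj (Phi a (Z.of_nat j - Z.of_nat n) (RtoC t)))))
        (Phi a (Z.of_nat j - Z.of_nat n) (RtoC x0))) (2 * n) =
        Cmul (f t) (RtoC (/ PI * (sin (theta a n t - theta a n x0) / (t - x0))))).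
    { intros t Ht. specialize (Ht O); simpl in Ht.
      transitivity (Cmul (Cmul (RtoC (1 / PI)) (f t))
        (RtoC (sin (theta a n t - theta a n x0) / (t - x0)))).
      - rewrite <- (kernel_sum a n t x0 Ha Ht). cbv zeta. rewrite <- Csum_mul_l.
        apply Csum_ext; intros; ring.
      - unfold Rdiv. rewrite Rmult_1_l.
        apply Cx_eq; unfold Cmul, RtoC, Re, Im; simpl; ring. }
    destruct H as [H1 H2].
    split; (eapply gint_ext; [intros t Ht; rewrite <- (E t Ht); reflexivity|]); assumption. }
  assert (Hscal : forall h (J : R) n,
    gint (fun t => h t * (/ PI * (sin (theta a n t - theta a n x0) / (t - x0)))) J ->
    gint (fun t => h t * (sin (theta a n t - theta a n x0) / (t - x0))) (PI * J)).
  { intros h J n H. apply gint_scal with (c := PI) in H.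
    apply gint_ext with (e' := fun _ => x0) (2 := H).
    intros t Ht; specialize (Ht O); simpl in Ht; field; lra. }
  assert (Hin : forall y, 0 < y < delta -> forall g : R -> Cx, restr_0d delta g y = g y).
  { intros y Hy g; unfold restr_0d. destruct (Rlt_dec 0 y), (Rlt_dec y delta); tauto || lra. }
  assert (Hout : forall y, y < 0 \/ delta < y -> forall g : R -> Cx, restr_0d delta g y = RtoC 0).
  { intros y Hy g; unfold restr_0d. destruct (Rlt_dec 0 y), (Rlt_dec y delta); tauto || lra. }
  assert (HRe : is_lim_seq (fun n => PI * Re (Spartial a c n x0)) ((Re Lp + Re Lm) * (PI / 2))).
  { apply (dini_limit a x0 delta (Re Lp) (Re Lm) _ _ _ (fun t => Re (f t)) _ _ _
             Ha Hn Hs Hdel HfR HpR HmR).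
    - intros y Hy; cbv beta. rewrite !Hin by exact Hy.
      unfold Cdiv, Cmul, Cinv, Csub, Cadd, Copp, RtoC, Re, Im; simpl. split; field; lra.
    - intros y Hy; cbv beta. rewrite !Hout by exact Hy. split; reflexivity.
    - intros n. apply Hscal. destruct (HS n) as [H _].
      eapply gint_ext with (e' := fun _ => 0); [|exact H].
      intros t _; unfold Cmul, RtoC, Re, Im; simpl; ring. }
  assert (HIm : is_lim_seq (fun n => PI * Im (Spartial a c n x0)) ((Im Lp + Im Lm) * (PI / 2))).
  { apply (dini_limit a x0 delta (Im Lp) (Im Lm) _ _ _ (fun t => Im (f t)) _ _ _
             Ha Hn Hs Hdel HfI HpI HmI).
    - intros y Hy; cbv beta. rewrite !Hin by exact Hy.
      unfold Cdiv, Cmul, Cinv, Csub, Cadd, Copp, RtoC, Re, Im; simpl. split; field; lra.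
    - intros y Hy; cbv beta. rewrite !Hout by exact Hy. split; reflexivity.
    - intros n. apply Hscal. destruct (HS n) as [_ H].
      eapply gint_ext with (e' := fun _ => 0); [|exact H].
      intros t _; unfold Cmul, RtoC, Re, Im; simpl; ring. }
  intros eps Heps.
  apply is_lim_seq_eps with (eps := PI * (eps / 2)) in HRe;
    [|apply Rmult_lt_0_compat; lra].
  apply is_lim_seq_eps with (eps := PI * (eps / 2)) in HIm;
    [|apply Rmult_lt_0_compat; lra].
  destruct HRe as [N1 HN1], HIm as [N2 HN2]. exists (max N1 N2); intros n Hnn.
  specialize (HN1 n ltac:(lia)). specialize (HN2 n ltac:(lia)).
  (* Real and imaginary parts get [eps / 2] each: the sum of squares stays below [eps ^ 2 / 2]. *)
  assert (Hsmall : forall p q l, Rabs (PI * p - (q + l) * (PI / 2)) < PI * (eps / 2) ->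
            (p - (l + q) / 2) ^ 2 < (eps / 2) ^ 2).
  { intros p q l H.
    replace (PI * p - (q + l) * (PI / 2)) with (PI * (p - (l + q) / 2)) in H by field.
    rewrite Rabs_mult, (Rabs_right PI) in H by lra. apply Rmult_lt_reg_l in H; [|lra].
    rewrite <- (pow2_abs (p - (l + q) / 2)). pose proof (Rabs_pos (p - (l + q) / 2)). nra. }
  apply Hsmall in HN1, HN2. apply Cnorm_lt; [exact Heps|].
  set (z := Spartial a c n x0) in *. clearbody z.
  apply Rle_lt_trans with
    ((Re z - (Re Lm + Re Lp) / 2) ^ 2 + (Im z - (Im Lm + Im Lp) / 2) ^ 2).
  - right. unfold Csub, Cadd, Copp, Cmul, RtoC, Re, Im; simpl. field.
  - nra.
Qed.
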